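(* Let $g\ge0$ and $d\ge1$ be integers, let $\eta=(n_1,\dots,n_k)$ and $\nu=(m_1,\dots,m_l)$ be partitions of $d$, and let $s=2g-2+k+l$ (assumed $\geq 0$). The double Hurwitz number $H_d^g(\eta,\nu)$ equals the sum, over all monodromy graphs for $(g,\eta,\nu)$, of the product of the following factors: (i) the number $\epsilon(\eta)$ of elements of $S_d$ of cycle type $\eta$; (ii) $|\mathrm{Aut}(\eta)|$; (iii) for every (three-valent) vertex, the product of the weights of the edges coming into the vertex from the left; (iv) a factor of $1/2$ for every balanced fork and for every wiener; (v) $1/d!$.
   Context: **Hurwitz number.** Fix distinct points $p_1,p_2,q_1,\dots,q_s\in\mathbb{P}^1_{\mathbb{C}}$. $H^g_d(\eta,\nu)$ is the number of isomorphism classes of degree $d$ covers $\pi:C\to\mathbb{P}^1$ with $C$ a smooth connected curve of genus $g$, $\pi$ unramified outside the fixed points, with ramification profile $\eta$ over $p_1$ and $\nu$ over $p_2$, and simple ramification over each $q_i$; each cover is counted with weight $1/|\mathrm{Aut}(\pi)|$ (preimages of $p_1,p_2$ are not marked). Equivalently, it is $1/d!$ times the number of tuples $(\sigma_\eta,\tau_1,\dots,\tau_s,\sigma_\nu)$ in $S_d$ with $\sigma_\nu\tau_s\cdots\tau_1\sigma_\eta=1$, $\sigma_\eta,\sigma_\nu$ of cycle types $\eta,\nu$, each $\tau_i$ a transposition, and generating a transitive subgroup of $S_d$. **Monodromy graphs.** A monodromy graph for $(g,\eta,\nu)$ is an abstract graph with positive integer edge weights together with a map to the segment $[0,s+1]$,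 constructed as follows. (a) Start with $k$ strands over $0$ of weights $n_1,\dots,n_k$. (b) Over the point $1$ create one three-valent vertex by either joining two strands or splitting one strand of weight strictly greater than $1$. In case of a join, the new strand gets the sum of the weights of the two joined strands; in case of a cut, the two new strands are labeled in all possible ways by positive integers adding to the weight of the split strand. (c) Keep only one representative of each isomorphism class of weighted graphs over the segment. (d) Repeat (b) and (c) over each successive integer up to $s$. (e) Retain all connected graphs that end with $l$ points of weights $m_1,\dots,m_l$ over $s+1$. Thus graphs are considered up to isomorphism compatible with edge weights and with the map to $[0,s+1]$; relative positions and crossings of strands are irrelevant, and strands over $0$ and $s+1$ carry no labels other than their weights. ''From the left'' means from the side of $0$. **Further notation.** $\mathrm{Aut}(\eta)$ is the group of permutations of the parts of $\eta$ preserving their sizes. A balanced fork is a tripod (a three-valent vertex with its three edges) with weights $n,n,2n$ such that the two edges of weight $n$ have their other endpoints both over $0$ or both over $s+1$. A wiener consists of a strand of weight $2n$ splitting into two strands of weight $n$ which then re-join (with each other). *)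

(* Defs.v *)
From HB Require Import structures.
From mathcomp Require Import all_boot all_order all_algebra all_fingroup.

Set Implicit Arguments.
Unset Strict Implicit.
Unset Printing Implicit Defensive.

Definition is_partition (d : nat) (eta : seq nat) : bool :=
  [&& sorted geq eta, all (leq 1) eta & sumn eta == d].

(* s = 2g - 2 + k + l; the truncated subtraction is harmless as soon as
   2 <= 2g + k + l. *)
Definition nb_branch (g : nat) (eta nu : seq nat) : nat :=
  2 * g + size eta + size nu - 2.

(** ** Hurwitz numbers, through monodromy representations *)

Definition has_cycle_type (d : nat) (sigma : 'S_d) (eta : seq nat) : bool :=
  perm_eq [seq #|(c : {set 'I_d})| | c <- enum (porbits sigma)] eta.

Definition is_transposition (d : nat) (tau : 'S_d) : bool :=
  [exists x : 'I_d, exists y : 'I_d, (x != y) && (tau == tperm x y)].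

(* The product of permutations in MathComp applies the left factor first: the
   product below is sigma_nu o tau_s o ... o tau_1 o sigma_eta. *)
Definition is_hurwitz_tuple (d s : nat) (eta nu : seq nat)
    (x : 'S_d * {ffun 'I_s -> 'S_d} * 'S_d) : bool :=
  let: (sigma_eta, tau, sigma_nu) := x in
  [&& has_cycle_type sigma_eta eta,
      has_cycle_type sigma_nu nu,
      [forall i, is_transposition (tau i)],
      (sigma_eta * (\prod_(i < s) tau i) * sigma_nu == 1)%g
    & [transitive <<[set sigma_eta; sigma_nu] :|: [set tau i | i : 'I_s]>>%g,
        on [set: 'I_d] | 'P] ].

Definition hurwitz (g d : nat) (eta nu : seq nat) : rat :=
  (#|[set x | @is_hurwitz_tuple d (nb_branch g eta nu) eta nu x]|%:R
     / d`!%:R)%R.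

(** ** Monodromy graphs *)

(* A graph over the segment [0, s+1] has exactly one three-valent vertex over
   each of 1, ..., s, so such a vertex is named by its position.  An edge is
   given by the positions of its left and right endpoints and its weight; an
   endpoint at position 0 or s+1 is an end of its own, not shared with any other
   edge. *)
Record edge := Edge { src : nat; tgt : nat; wt : nat }.

Definition edge_code (e : edge) : nat * nat * nat := (src e, tgt e, wt e).
Definition edge_decode (c : nat * nat * nat) : edge := Edge c.1.1 c.1.2 c.2.
Lemma edge_codeK : cancel edge_code edge_decode.
Proof. by case. Qed.
HB.instance Definition _ := Equality.copy edge (can_type edge_codeK).

Definition mgraph := seq edge.

(* An isomorphism over the segment fixes every three-valent vertex, hence is a
   bijection between the edges preserving both endpoint positions and weights. *)
Definition iso (G H : mgraph) : bool := perm_eq G H.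

Fixpoint iso_reps (L : seq mgraph) : seq mgraph :=
  if L is G :: L' then
    let R := iso_reps L' in if has (iso G) R then R else G :: R
  else [::].

Section Construction.

Variable s : nat.

(* During the construction, a strand that has not yet reached a vertex is drawn
   all the way to s+1. *)
Definition start (eta : seq nat) : mgraph := [seq Edge 0 s.+1 n | n <- eta].

Definition strands (G : mgraph) : seq edge := [seq e <- G | tgt e == s.+1].

Definition join (v : nat) (G : mgraph) (e f : edge) : mgraph :=
  [:: Edge (src e) v (wt e), Edge (src f) v (wt f), Edge v s.+1 (wt e + wt f)
    & rem f (rem e G)].

Definition cut (v : nat) (G : mgraph) (e : edge) (a : nat) : mgraph :=
  [:: Edge (src e) v (wt e), Edge v s.+1 a, Edge v s.+1 (wt e - a)
    & rem e G].

(* No cut arises from a strand of weight 1, since [iota 1 0] is empty. *)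
Definition moves (v : nat) (G : mgraph) : seq mgraph :=
  [seq join v G e f | e <- strands G, f <- rem e (strands G)]
  ++ [seq cut v G e a | e <- strands G, a <- iota 1 (wt e).-1].

Fixpoint partial_graphs (eta : seq nat) (i : nat) : seq mgraph :=
  if i is j.+1 then
    iso_reps (flatten [seq moves j.+1 G | G <- partial_graphs eta j])
  else [:: start eta].

Definition incident (v : nat) (e : edge) : bool := (src e == v) || (tgt e == v).

Definition adjacent (e f : edge) : bool :=
  has (fun v => incident v e && incident v f) (iota 1 s).

Definition connected (G : mgraph) : bool :=
  [forall i, forall j,
     connect (fun i j : 'I_(size G) =>
       adjacent (tnth (in_tuple G) i) (tnth (in_tuple G) j)) i j].

Definition final_weights (G : mgraph) : seq nat := map wt (strands G).

Definition tripod (v : nat) (G : mgraph) : seq edge :=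
  [seq e <- G | incident v e].

(* The edges of the tripod at v are e, e and f, where the two copies of e are
   distinct edges of the graph with the same endpoint positions and the same
   weight n, and f has weight 2n. *)
Definition balanced_at (v : nat) (G : mgraph) (e f : edge) : bool :=
  perm_eq (tripod v G) [:: e; e; f] && (wt f == 2 * wt e).

Definition balanced_fork (G : mgraph) (v : nat) : bool :=
  has (fun e => has (fun f => balanced_at v G e f
                       && ((src e == 0) || (tgt e == s.+1))) G) G.

(* A wiener is recorded at its splitting vertex v: f enters v and the two copies
   of e go from v to a common three-valent vertex, not to ends over s+1. *)
Definition wiener (G : mgraph) (v : nat) : bool :=
  has (fun e => has (fun f => balanced_at v G e f
                       && [&& tgt f == v, src e == v & tgt e <= s]) G) G.

Definition vertex_weight (G : mgraph) (v : nat) : nat :=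
  \prod_(e <- G | tgt e == v) wt e.

End Construction.

Definition monodromy_graphs (g : nat) (eta nu : seq nat) : seq mgraph :=
  let s := nb_branch g eta nu in
  [seq G <- partial_graphs s eta s
     | connected s G && perm_eq (final_weights s G) nu].

Definition epsilon (d : nat) (eta : seq nat) : nat :=
  #|[set sigma : 'S_d | has_cycle_type sigma eta]|.

Definition aut_size (eta : seq nat) : nat :=
  #|[set p : 'S_(size eta) | [forall i, nth 0 eta (p i) == nth 0 eta i]]|.

Definition nb_balanced_forks (s : nat) (G : mgraph) : nat :=
  count (balanced_fork s G) (iota 1 s).

Definition nb_wieners (s : nat) (G : mgraph) : nat :=
  count (wiener s G) (iota 1 s).

(* Main.v *)
(* Follow the cycles of sigma_eta tau_1 ... tau_i as i grows: each transposition
   joins two cycles or cuts one, so a tuple of permutations draws a monodromy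
   graph G whose strands are the cycles.  Write |Aut G| for the number of
   permutations of the edges of G preserving endpoints and weights.  By
   induction on i, the number of tuples drawing G is
     epsilon(eta) |Aut(eta)| prod_v (weights entering v) / |Aut G|.
   Indeed G determines the graph it was obtained from by one move, and counting
   the ordered pairs (x, y) for which the transposition of x and y performs that
   move gives exactly the incoming weight at the new vertex times the ratio of
   the two automorphism numbers.  A tuple generates a transitive group if and
   only if its graph is connected: both mean that an invariant set of points,
   or equivalently a 2-colouring of the edges constant at every vertex, is
   trivial.  Finally two distinct edges of a connected graph with the same
   endpoints and the same weight form a balanced fork or a wiener, whence
   |Aut G| = 2^(forks + wieners). *)

(* The factors 1/2 make sense only for finished connected graphs. On the way the graph is usually
   disconnected and many strands may be equal, so the induction carries the whole order of the
   symmetry group, here [nb_sym]. Weighted in this way, joins and cuts obey the same rule. A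
   transposition is an unordered pair; it comes from two ordered pairs performing the move exactly
   when the two joined strands are equal, or the two pieces of the cut are, and this is also when
   the edges at the new vertex contribute a symmetry of order two. The other multiplicities are
   choices among equal strands, which cancel against symmetries of the old graph. Since a graph
   records an edge by endpoints and weight only, equal strands cannot be told apart there; runs
   therefore keep a cycle along with each edge and forget it when they are compared with the
   construction. At the end, for s > 0, connectedness makes every edge meet a vertex, and trivalency
   then bounds each multiplicity by two. *)
Require Import Defs.
From mathcomp Require Import all_boot all_order all_algebra all_fingroup zify.

Set Implicit Arguments.
Unset Strict Implicit.
Unset Printing Implicit Defensive.

(** * Symmetries and cycles *)

(* The product of the factorials of the multiplicities of the entries of [s],
   that is, the order of the group of permutations of [s] preserving entries. *)
Fixpoint nb_sym (T : eqType) (s : seq T) : nat :=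
  if s is x :: s' then (count_mem x s').+1 * nb_sym s' else 1.

Section NbSym.

Variable T : eqType.
Implicit Types (x : T) (s t : seq T).

(** The recursion reads the entries in order; this form is symmetric in them. It gives invariance
    under permutation and later one factor per distinct edge. *)
Lemma nb_sym_fact s :
  nb_sym s = \prod_(x <- undup s) (count_mem x s)`!.
Proof.
elim: s => [|x s IH] /=; first by rewrite big_nil.
have E y : y \in undup s -> y != x ->
    (count_mem y (x :: s))`! = (count_mem y s)`!.
  by move=> _ yx /=; rewrite eq_sym (negbTE yx).
case: ifPn => xs.
  rewrite IH (perm_big _ (perm_to_rem (_ : x \in undup s))) ?mem_undup //=.
  rewrite [RHS](perm_big _ (perm_to_rem (_ : x \in undup s))) ?mem_undup //=.
  rewrite !big_cons eqxx add1n factS mulnA; congr (_ * _).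
  rewrite !big_seq; apply: eq_bigr => y.
  rewrite rem_filter ?undup_uniq // mem_filter /= => /andP[yx _].
  by rewrite eq_sym (negbTE yx).
rewrite big_cons /= eqxx (count_memPn xs) /= mul1n IH mul1n !big_seq.
apply: eq_bigr => y; rewrite mem_undup => ys.
by have /negbTE -> : x != y by apply: contraNneq xs => ->.
Qed.

Lemma nb_sym_perm s t : perm_eq s t -> nb_sym s = nb_sym t.
Proof.
move=> st; rewrite !nb_sym_fact (perm_big (undup t)) ?perm_undup //=.
  by apply: eq_bigr => x _; rewrite (seq.permP st).
exact: perm_mem.
Qed.

End NbSym.

Lemma nb_sym_map_inj (T U : eqType) (f : T -> U) (s : seq T) :
  injective f -> nb_sym (map f s) = nb_sym s.
Proof.
move=> f_inj; elim: s => //= x s ->; rewrite count_map.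
by congr (_.+1 * _); apply: eq_count => y /=; rewrite inj_eq.
Qed.

Section FibrePermutations.

Variables (T : finType) (U : eqType) (f : T -> U).

(** Prescribing the support A lets an induction shrink the list of moved points while the ambient
    type stays fixed. *)
Definition fibre_perms (A : {set T}) : {set {perm T}} :=
  [set p | perm_on A p && [forall x, f (p x) == f x]].

Lemma fibre_perms_group_set A : group_set (fibre_perms A).
Proof.
apply/group_setP; split=> [|p q].
  by rewrite inE perm_on1; apply/forallP => x; rewrite perm1.
rewrite !inE => /andP[Ap /forallP fp] /andP[Aq /forallP fq].
rewrite perm_onM //=; apply/forallP => x.
by rewrite permM (eqP (fq _)) (eqP (fp _)).
Qed.
Canonical fibre_perms_group A := Group (fibre_perms_group_set A).

Lemma orbit_fibre_perms (A : {set T}) x : x \in A ->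
  orbit 'P (fibre_perms A) x = [set y in A | f y == f x].
Proof.
move=> xA; apply/setP=> y; rewrite inE; apply/orbitP/andP.
  case=> p; rewrite inE => /andP[Ap /forallP fp] <- /=.
  by rewrite /aperm perm_closed.
case=> yA /eqP fyx; exists (tperm x y); last by rewrite /= /aperm tpermL.
rewrite inE; apply/andP; split.
  by apply/subsetP => z; rewrite inE; case: tpermP => [-> | -> |]; rewrite ?eqxx.
by apply/forallP => z; case: tpermP => [-> | -> |] //=; rewrite fyx.
Qed.

Lemma stab_fibre_perms (A : {set T}) x :
  ('C_(fibre_perms A)[x | 'P])%g = fibre_perms (A :\ x).
Proof.
apply/setP=> p; rewrite !inE sub1set inE /= /aperm -!andbA.
apply/and3P/andP => [[Ap fp /eqP px] | [Ap fp]].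
  split=> //; apply/subsetP => z; rewrite !inE => pz.
  have := subsetP Ap z; rewrite inE => -> //; rewrite andbT.
  by apply: contraNneq pz => ->; rewrite px.
split=> //; last by rewrite (out_perm Ap) // !inE eqxx.
by apply: (subset_trans Ap); apply: subsetDl.
Qed.

(** Orbit-stabiliser at the head of the list: its orbit is its fibre, of size [(count_mem _ _).+1],
    and its stabiliser is the group of the tail. These are the two factors in the recursion of
    [nb_sym]. *)
Lemma card_fibre_perms (r : seq T) : uniq r ->
  #|fibre_perms [set x in r]| = nb_sym (map f r).
Proof.
elim: r => [_|x r IH] /=.
  apply/eqP/cards1P; exists 1%g; apply/setP=> p; rewrite !inE.
  apply/andP/eqP => [[Ap _]|->]; last first.
    by rewrite perm_on1; split=> //; apply/forallP => x; rewrite perm1.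
  by apply/permP => x; rewrite perm1 (out_perm Ap) // inE.
case/andP=> xr ur; rewrite -IH //.
have xA : x \in [set y in x :: r] by rewrite !inE eqxx.
rewrite -(card_orbit_stab 'P (fibre_perms_group [set y in x :: r]) x) /=.
rewrite orbit_fibre_perms // stab_fibre_perms; congr (_ * _); last first.
  congr #|fibre_perms _|; apply/setP => y; rewrite !inE.
  by case: eqP => // ->; rewrite (negbTE xr).
rewrite count_map -size_filter -(card_uniqP (filter_uniq _ ur)).
rewrite (cardsD1 x) !inE !eqxx add1n; congr _.+1; apply: eq_card => y.
rewrite !inE mem_filter /=; case: (eqVneq y x) => [->|_] /=.
  by rewrite (negbTE xr) andbF.
by rewrite andbC.
Qed.

End FibrePermutations.

Lemma aut_sizeE (eta : seq nat) : aut_size eta = nb_sym eta.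
Proof.
rewrite /aut_size -[in RHS](mkseq_nth 0 eta) /mkseq -val_enum_ord -map_comp.
rewrite -card_fibre_perms ?enum_uniq //; apply: eq_card => p; rewrite !inE /=.
suff -> : perm_on [set x in enum 'I_(size eta)] p by [].
by apply/subsetP => i _; rewrite inE mem_enum.
Qed.

Section Porbits.

Variable T : finType.

Lemma porbit_subset (p : {perm T}) (A : {set T}) z :
  (forall u, u \in A -> p u \in A) -> z \in A -> porbit p z \subset A.
Proof.
move=> pA zA; apply/subsetP => u /porbitP[i ->].
by elim: i => [|i IH]; rewrite ?expg0 ?perm1 // expgSr permM pA.
Qed.

Lemma mem_porbit_step (p : {perm T}) u z :
  (p u \in porbit p z) = (u \in porbit p z).
Proof. by rewrite -!eq_porbit_mem -(porbit_perm p 1 u) expg1. Qed.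

Lemma iter_inj_porbit (pi : {perm T}) x i j :
  i < #|porbit pi x| -> j < #|porbit pi x| ->
  ((pi ^+ i)%g x == (pi ^+ j)%g x) = (i == j).
Proof.
move=> lti ltj.
rewrite !permX -(nth_traject pi lti) -(nth_traject pi ltj).
by rewrite nth_uniq ?size_traject ?uniq_traject_porbit.
Qed.

End Porbits.

(** The transposition acts after [pi] and moves only x and y, so the two orbits of x agree until
    [pi] first reaches x or y. *)
Lemma expg_mul_tperm (T : finType) (pi : {perm T}) (x y : T) b k :
  (forall j, 0 < j < b -> (pi ^+ j)%g x != x /\ (pi ^+ j)%g x != y) ->
  k < b -> ((pi * tperm x y) ^+ k)%g x = (pi ^+ k)%g x.
Proof.
move=> H; elim: k => [|k IH] kb; first by rewrite !expg0.
rewrite !expgSr permM IH ?permM; last exact: ltnW.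
have := H k.+1; rewrite expgSr permM kb => /(_ isT)[hx hy].
by rewrite tpermD // eq_sym.
Qed.

Section PorbitsJoin.

Variables (T : finType) (pi : {perm T}).

(** The new orbit of x runs through the whole old cycle of x; at the step where [pi] would return to
    x, the transposition sends it to y instead. *)
Let join_aux (x y : T) : y \notin porbit pi x ->
  porbit pi x \subset porbit (pi * tperm x y) x
  /\ y \in porbit (pi * tperm x y) x.
Proof.
move=> yx; set n := #|porbit pi x|.
have n0 : 0 < n by rewrite lt0n card_porbit_neq0.
have E k : k < n -> ((pi * tperm x y) ^+ k)%g x = (pi ^+ k)%g x.
  apply: expg_mul_tperm => j /andP[j0 jn]; split.
    by rewrite -[X in _ != X](perm1 x) -(expg0 pi) iter_inj_porbit // -lt0n.
  by apply: contraNneq yx => <-; rewrite mem_porbit.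
split.
  apply/subsetP => z; rewrite porbit_traject => /trajectP[k kn ->].
  by rewrite -permX -E // mem_porbit.
apply/porbitP; exists n; symmetry.
have pix : pi ((pi ^+ n.-1)%g x) = x.
  by rewrite -permM -expgSr prednK // permX iter_porbit.
by rewrite -[in LHS](prednK n0) expgSr permM E ?prednK // permM pix tpermL.
Qed.

Lemma porbit_join (x y z : T) : y \notin porbit pi x ->
  z \in porbit pi x :|: porbit pi y ->
  porbit (pi * tperm x y) z = porbit pi x :|: porbit pi y.
Proof.
move=> yx zxy; set pi' := (pi * _)%g.
have [sx y'x] := join_aux yx.
have [] := @join_aux y x; first by rewrite porbit_sym.
rewrite tpermC -/pi' => sy x'y.
have exy : porbit pi' x = porbit pi' y by apply/eqP; rewrite eq_porbit_mem.
have exA : porbit pi' x = porbit pi x :|: porbit pi y.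
  apply/eqP; rewrite eqEsubset; apply/andP; split; last first.
    by rewrite subUset sx exy sy.
  apply: porbit_subset; last by rewrite inE porbit_id.
  move=> u uA; rewrite permM.
  case: tpermP => _; rewrite ?inE ?porbit_id ?orbT //.
  by move=> _; move: uA; rewrite !inE !mem_porbit_step.
rewrite -exA; apply/eqP; rewrite eq_porbit_mem exA //.
Qed.

End PorbitsJoin.

Section PorbitsCut.

Variables (T : finType) (pi : {perm T}).

(** The new orbit of x follows [pi] for a - 1 steps; the next one would reach y, which the
    transposition replaces by x, so the cycle closes with a points. *)
Let cut_aux (x : T) a (y := (pi ^+ a)%g x) (pi' := (pi * tperm x y)%g) :
  0 < a < #|porbit pi x| ->
  [/\ #|porbit pi' x| = a, porbit pi' x \subset porbit pi x
     & y \notin porbit pi' x].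
Proof.
case/andP=> a0 an.
have E k : k < a -> (pi' ^+ k)%g x = (pi ^+ k)%g x.
  apply: expg_mul_tperm => j /andP[j0 ja]; split.
    by rewrite -[X in _ != X](perm1 x) -(expg0 pi) iter_inj_porbit //; lia.
  by rewrite /y iter_inj_porbit //; lia.
pose A := [set (pi ^+ (k : 'I_a))%g x | k : 'I_a].
have cA : #|A| = a.
  rewrite card_imset ?card_ord // => i j /eqP; rewrite iter_inj_porbit.
  - by move/eqP/val_inj.
  - exact: ltn_trans an.
  - exact: ltn_trans an.
have exA : porbit pi' x = A.
  apply/eqP; rewrite eqEsubset; apply/andP; split; last first.
    by apply/subsetP => _ /imsetP[k _ ->]; rewrite -E ?ltn_ord // mem_porbit.
  apply: porbit_subset; last first.
    by apply/imsetP; exists (Ordinal a0) => //; rewrite expg0 perm1.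
  move=> _ /imsetP[k _ ->]; have [ka|] := ltnP k.+1 a.
    apply/imsetP; exists (Ordinal ka) => //.
    by rewrite -[RHS](E k.+1) // expgSr [RHS]permM E.
  move=> ak; have {ak}ka : a = k.+1 by apply/eqP; rewrite eqn_leq ak ltn_ord.
  have -> : pi' ((pi ^+ k)%g x) = x.
    by rewrite permM -[pi _]permM -expgSr -ka -/y tpermR.
  by apply/imsetP; exists (Ordinal a0) => //; rewrite expg0 perm1.
split; rewrite ?exA //.
  by apply/subsetP => _ /imsetP[k _ ->]; rewrite mem_porbit.
apply/imsetP=> -[k _ /eqP]; rewrite /y iter_inj_porbit //; last first.
  exact: ltn_trans an.
by rewrite gtn_eqF.
Qed.

(** The situation is symmetric: x lies [n - a] steps after y. The two new cycles are disjoint, and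
    their sizes a and [n - a] add up to n, so they fill the old cycle. *)
Lemma porbit_cut (x : T) a (y := (pi ^+ a)%g x) (pi' := (pi * tperm x y)%g) :
  0 < a < #|porbit pi x| ->
  [/\ #|porbit pi' x| = a, #|porbit pi' y| = #|porbit pi x| - a,
      y \notin porbit pi' x & porbit pi' x :|: porbit pi' y = porbit pi x].
Proof.
move=> an; have [c1 s1 nyx] := cut_aux an; rewrite -/y -/pi' in c1 s1 nyx.
set n := #|porbit pi x| in an *.
have ey : porbit pi y = porbit pi x by rewrite porbit_perm.
have xE : (pi ^+ (n - a))%g y = x.
  by rewrite /y -permM -expgD subnKC ?permX ?iter_porbit //; lia.
have := @cut_aux y (n - a); rewrite /= ey xE (tpermC y) -/pi' -/n.
case=> [|c2 s2 nxy]; first lia.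
split=> //; apply/eqP; rewrite eqEcard subUset s1 s2 /= cardsU c1 c2 -/n.
suff -> : porbit pi' x :&: porbit pi' y = set0 by rewrite cards0; lia.
apply/setP => u; rewrite !inE; apply: contraNF nyx => /andP[].
by rewrite -!eq_porbit_mem => /eqP -> /eqP ->.
Qed.

End PorbitsCut.

(** * Moves *)

Lemma eq_tperm (T : finType) (x y u v : T) : x != y ->
  (tperm x y == tperm u v) = ((x, y) == (u, v)) || ((x, y) == (v, u)).
Proof.
move=> xy; apply/eqP/orP => [E | [/eqP[-> ->] | /eqP[-> ->]]] //; last first.
  exact: tpermC.
have := tpermL x y; rewrite E; case: tpermP => [-> <-|-> <-|_ _ e].
- by left.
- by right.
- by rewrite e eqxx in xy.
Qed.

(** A transposition comes from the two ordered pairs (u, v) and (v, u), and the boolean b says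
    whether P accepts both or just one. In the applications b is the coincidence of two strands. *)
Lemma card_transpositions (d : nat) (P : rel 'I_d) (Q : pred 'S_d) (b : bool) :
  (forall x y, P x y -> x != y) ->
  (forall x y, x != y -> Q (tperm x y) = P x y || P y x) ->
  (forall x y, P x y -> P y x = b) ->
  #|[set t | is_transposition t && Q t]| * b.+1
    = #|[set p : 'I_d * 'I_d | P p.1 p.2]|.
Proof.
move=> Pneq PQ Pb; rewrite -[in RHS]sum1_card.
rewrite (partition_big (fun p => tperm p.1 p.2)
           (mem [set t | is_transposition t && Q t])) /=.
  rewrite -sum_nat_const; apply: eq_bigr => t; rewrite inE => /andP[].
  case/existsP=> u /existsP[v /andP[uv /eqP-> {t}]] Quv.
  transitivity (#|[set p in [set (u, v); (v, u)] | P p.1 p.2]|); last first.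
    rewrite -sum1_card; apply: eq_bigl => -[x y]; rewrite !inE /=.
    case Pxy: (P x y); rewrite ?andbF //= andbT eq_tperm ?Pneq //.
  have neq : (u, v) != (v, u) by apply: contraNneq uv => -[->].
  have : P u v || P v u by rewrite -PQ.
  case Puv: (P u v); case Pvu: (P v u) => //= _.
  - have -> : b = true by rewrite -(Pb _ _ Puv).
    transitivity #|[set (u, v); (v, u)]|; first by rewrite cards2 neq.
    apply: eq_card => p; rewrite !inE.
    by case: eqP => [->|_] /=; [rewrite Puv | case: eqP => [->|]; rewrite ?Pvu].
  - have -> : b = false by rewrite -(Pb _ _ Puv).
    rewrite -(cards1 (u, v)); apply: eq_card => p; rewrite !inE.
    by case: eqP => [->|_] /=; [rewrite Puv | case: eqP => [->|]; rewrite ?Pvu].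
  - have -> : b = false by rewrite -(Pb _ _ Pvu).
    rewrite -(cards1 (v, u)); apply: eq_card => p; rewrite !inE orbC.
    by case: eqP => [->|_] /=; [rewrite Pvu | case: eqP => [->|]; rewrite ?Puv].
move=> [x y]; rewrite !inE /= => Pxy; have xy := Pneq _ _ Pxy.
rewrite PQ // Pxy /= andbT.
by apply/existsP; exists x; apply/existsP; exists y; rewrite xy eqxx.
Qed.

Lemma iso_reps_subset (L : seq mgraph) : {subset iso_reps L <= L}.
Proof.
elim: L => //= G L IH H; case: ifP => _; rewrite !inE.
  by move/IH ->; rewrite orbT.
by case/orP=> [-> // | /IH ->]; rewrite orbT.
Qed.

Lemma has_iso_reps (L : seq mgraph) G :
  G \in L -> has (iso G) (iso_reps L).
Proof.
elim: L => //= H L IH; rewrite inE => /orP[/eqP <-|/IH {}IH]; case: ifP => //=.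
  by rewrite /iso perm_refl.
by rewrite IH orbT.
Qed.

Lemma count_iso_reps (L : seq mgraph) G : count (iso G) (iso_reps L) <= 1.
Proof.
elim: L => //= H L IH; case: ifPn => //= HL.
have [GH|] //= := boolP (iso G H); rewrite add1n ltnS leqn0.
rewrite -[_ == 0]negbK -lt0n -has_count.
apply: contraNN HL => /hasP[K KL GK]; apply/hasP; exists K => //.
by rewrite /iso -(permPl GH).
Qed.

Definition close (v : nat) (e : edge) : edge := Edge (src e) v (wt e).

Section Moves.

Variable s : nat.
Implicit Types (G H R : mgraph) (e f : edge) (v j a : nat).

(** Replaces the nested [rem] of a move by a common remainder R, so that both graphs can be compared
    entry by entry up to permutation. *)
Lemma join_or_cut v G H : H \in moves s v G ->
  (exists e f R, [/\ perm_eq G [:: e, f & R], tgt e = s.+1, tgt f = s.+1,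
     f \in rem e (strands s G)
     & H = [:: close v e, close v f, Edge v s.+1 (wt e + wt f) & R]])
  \/ (exists e a R, [/\ perm_eq G (e :: R), tgt e = s.+1, 0 < a < wt e
     & H = [:: close v e, Edge v s.+1 a, Edge v s.+1 (wt e - a) & R]]).
Proof.
rewrite mem_cat => /orP[] /allpairsPdep[e]; [case=> f | case=> a] => -[eS fS ->].
  left; exists e, f, (rem f (rem e G)).
  have [eG te] : e \in G /\ tgt e = s.+1.
    by move: eS; rewrite mem_filter => /andP[/eqP].
  have fS' : f \in strands s (rem e G).
    move: fS; rewrite (perm_mem (_ : perm_eq _ (strands s (rem e G)))) //.
    rewrite -(perm_cons e) -(permPl (perm_to_rem eS)).
    by rewrite (permPl (perm_filter _ (perm_to_rem eG))) /= te eqxx.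
  have [fG tf] : f \in rem e G /\ tgt f = s.+1.
    by move: fS'; rewrite mem_filter => /andP[/eqP].
  split=> //; rewrite (permPl (perm_to_rem eG)) perm_cons.
  exact: perm_to_rem.
right; exists e, a, (rem e G).
have [eG te] : e \in G /\ tgt e = s.+1.
  by move: eS; rewrite mem_filter => /andP[/eqP].
split=> //; first exact: perm_to_rem.
by move: fS; rewrite mem_iota; lia.
Qed.

Lemma has_iso_join v G e f R H : perm_eq G [:: e, f & R] ->
  tgt e = s.+1 -> tgt f = s.+1 ->
  perm_eq H [:: close v e, close v f, Edge v s.+1 (wt e + wt f) & R] ->
  has (iso H) (moves s v G).
Proof.
move=> GE te tf HE.
have eG : e \in G by rewrite (perm_mem GE) inE eqxx.
have SE : perm_eq (strands s G) [:: e, f & strands s R].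
  by rewrite (permPl (perm_filter _ GE)) /= te tf eqxx.
have eS : e \in strands s G by rewrite (perm_mem SE) inE eqxx.
have RE : perm_eq (rem e G) (f :: R).
  by rewrite -(perm_cons e) -(permPl (perm_to_rem eG)).
have RE' : perm_eq (rem e (strands s G)) (f :: strands s R).
  by rewrite -(perm_cons e) -(permPl (perm_to_rem eS)).
apply/hasP; exists (join s v G e f).
  rewrite mem_cat; apply/orP; left; apply/allpairsPdep; exists e, f; split=> //.
  by rewrite (perm_mem RE') inE eqxx.
rewrite /iso (permPl HE) /join !perm_cons -(perm_cons f) -(permPl RE).
by apply: perm_to_rem; rewrite (perm_mem RE) inE eqxx.
Qed.

Lemma has_iso_cut v G e a R H : perm_eq G (e :: R) ->
  tgt e = s.+1 -> 0 < a < wt e ->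
  perm_eq H [:: close v e, Edge v s.+1 a, Edge v s.+1 (wt e - a) & R] ->
  has (iso H) (moves s v G).
Proof.
move=> GE te ae HE.
have eG : e \in G by rewrite (perm_mem GE) inE eqxx.
have eS : e \in strands s G by rewrite mem_filter te eqxx.
apply/hasP; exists (cut s v G e a).
  rewrite mem_cat; apply/orP; right; apply/allpairsPdep; exists e, a.
  by split=> //; rewrite mem_iota; lia.
rewrite /iso (permPl HE) /cut !perm_cons -(perm_cons e) -(permPl GE).
exact: perm_to_rem.
Qed.

(** The invariant after j moves. Its main consequence is that position [j.+1] occurs in no edge, so
    that the edges found there afterwards are those of the next move. *)
Definition staged j G :=
  all (fun e => [&& 0 < wt e, src e < tgt e, src e <= j
                  & (tgt e <= j) || (tgt e == s.+1)]) G.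

Lemma perm_staged j G H : perm_eq G H -> staged j G = staged j H.
Proof. exact: perm_all. Qed.

Definition fresh v R := all (fun e => (src e != v) && (tgt e != v)) R.

Lemma staged_fresh j G : j < s -> staged j G -> fresh j.+1 G.
Proof.
by move=> js /allP HG; apply/allP => e /HG /and4P[_ _ h1 h2]; lia.
Qed.

Lemma staged_widen j G : staged j G -> staged j.+1 G.
Proof. by apply: sub_all => e /and4P[-> -> h1 h2] /=; lia. Qed.

Lemma staged_moves j G H : j < s -> staged j G -> H \in moves s j.+1 G ->
  staged j.+1 H.
Proof.
move=> js HG /join_or_cut[[e [f [R [GE te tf _ ->]]]]|[e [a [R [GE te ae ->]]]]].
  move: HG; rewrite (perm_staged _ GE) /= => /and3P[he hf /staged_widen HR].
  by rewrite -/(staged j.+1 R) HR !andbT /=; lia.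
move: HG; rewrite (perm_staged _ GE) /= => /andP[he /staged_widen HR].
by rewrite -/(staged j.+1 R) HR !andbT /=; lia.
Qed.

(** Inverts the move at v without knowing whether it was a join or a cut. It works edge by edge and
    so respects isomorphism: a graph determines its predecessor. *)
Definition undo v G : mgraph :=
  [seq if tgt e == v then close s.+1 e else e | e <- G & src e != v].

Lemma perm_undo v G H : perm_eq G H -> perm_eq (undo v G) (undo v H).
Proof. by move=> GH; apply: perm_map; apply: perm_filter. Qed.

Lemma undo_fresh v R : fresh v R -> undo v R = R.
Proof.
elim: R => // e R IH /= /andP[/andP[h1 h2] HR].
by rewrite /undo /= h1 /= (negbTE h2) -/(undo v R) IH.
Qed.

Lemma closeK e v w : tgt e = w -> close w (close v e) = e.
Proof. by case: e => ? ? ? /= <-. Qed.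

Lemma undo_moves j G H : j < s -> staged j G -> H \in moves s j.+1 G ->
  perm_eq (undo j.+1 H) G.
Proof.
move=> js /(staged_fresh js) HG.
case/join_or_cut=> [[e [f [R [GE te tf _ ->]]]]|[e [a [R [GE te ae ->]]]]];
  rewrite perm_sym (permPl GE); move: HG; rewrite /fresh (perm_all _ GE) /=.
  case/and3P=> /andP[he _] /andP[hf _] /undo_fresh ER.
  by rewrite /undo /= he hf eqxx /= !eqxx -[map _ _]/(undo j.+1 R) ER !closeK.
case/andP=> /andP[he _] /undo_fresh ER.
by rewrite /undo /= he eqxx /= eqxx -[map _ _]/(undo j.+1 R) ER closeK.
Qed.

(** At the vertex of the last move these are the strands consumed (their former right endpoint being
    [s.+1]), and [opening] gives the weights produced. Both are isomorphism invariants, from which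
    the move can be read back. *)
Definition closing v G := [seq (src e, wt e) | e <- G & tgt e == v].
Definition opening v G := [seq wt e | e <- G & src e == v].

Lemma perm_closing v G H : perm_eq G H -> perm_eq (closing v G) (closing v H).
Proof. by move=> GH; apply: perm_map; apply: perm_filter. Qed.

Lemma perm_opening v G H : perm_eq G H -> perm_eq (opening v G) (opening v H).
Proof. by move=> GH; apply: perm_map; apply: perm_filter. Qed.

Lemma closing_cons v e G : closing v (e :: G)
  = if tgt e == v then (src e, wt e) :: closing v G else closing v G.
Proof. by rewrite /closing /=; case: ifP. Qed.

Lemma opening_cons v e G : opening v (e :: G)
  = if src e == v then wt e :: opening v G else opening v G.
Proof. by rewrite /opening /=; case: ifP. Qed.

Lemma closing_fresh v R : fresh v R -> closing v R = [::].
Proof.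
by elim: R => // e R IH /= /andP[/andP[_ /negbTE h] /IH]; rewrite closing_cons h.
Qed.

Lemma opening_fresh v R : fresh v R -> opening v R = [::].
Proof.
by elim: R => // e R IH /= /andP[/andP[/negbTE h _] /IH]; rewrite opening_cons h.
Qed.

Lemma vertex_weightE v G : vertex_weight G v = \prod_(x <- closing v G) x.2.
Proof. by rewrite /vertex_weight big_map big_filter. Qed.

End Moves.

(** * Graphs drawn by tuples of permutations *)

Section Touched.

Variable d : nat.
Implicit Types (pi t : 'S_d) (c : {set 'I_d}).

Definition touched t c := [exists z in c, t z != z].

Lemma touched_tperm (x y : 'I_d) c : x != y ->
  touched (tperm x y) c = (x \in c) || (y \in c).
Proof.
move=> xy; apply/existsP/orP => [[z /andP[zc]]|].
  by case: tpermP => [<-|<-|]; rewrite ?eqxx //; [left | right].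
case=> zc; [exists x | exists y]; rewrite zc ?tpermL ?tpermR //.
by rewrite eq_sym.
Qed.

Let untouched_aux pi t c : ~~ touched t c -> c \in porbits pi ->
  c \in porbits (pi * t).
Proof.
move=> /existsPn tc /imsetP[z _ cE]; apply/imsetP; exists z => //.
have E i : ((pi * t) ^+ i)%g z = (pi ^+ i)%g z.
  elim: i => [|i IH]; first by rewrite !expg0.
  rewrite !expgSr permM IH !permM; apply/eqP.
  have := tc (pi ((pi ^+ i)%g z)).
  by rewrite cE mem_porbit_step mem_porbit /= negbK.
rewrite cE; apply/setP=> u.
by apply/porbitP/porbitP => -[i ->]; exists i.
Qed.

Lemma mem_porbits_untouched pi t c : ~~ touched t c ->
  (c \in porbits (pi * t)) = (c \in porbits pi).
Proof.
move=> tc; apply/idP/idP => [|/(untouched_aux tc)] //.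
(* The converse is the same implication for [pi * t] multiplied by the inverse of t, which does not
   touch c either. *)
rewrite -[X in _ -> c \in porbits X](mulgK t pi); apply: untouched_aux.
apply: contra tc => /existsP[z /andP[zc tz]]; apply/existsP; exists z.
by rewrite zc /=; apply: contraNneq tz => {1}<-; rewrite permK.
Qed.

End Touched.

Section Runs.

Variables s d : nat.

(* An edge of the graph of a tuple of permutations, together with the cycle it
   stands for. *)
Definition cycle_edge := (edge * {set 'I_d})%type.

Definition state := ('S_d * seq cycle_edge)%type.

Implicit Types (pi t : 'S_d) (x : cycle_edge) (D : seq cycle_edge)
  (st : state) (j v : nat).

Definition advance v t x : cycle_edge :=
  if (tgt x.1 == s.+1) && touched t x.2 then (close v x.1, x.2) else x.

Definition new_strands v t pi : seq cycle_edge :=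
  [seq (Edge v s.+1 #|c|, c)
     | c : {set 'I_d} <- [seq c <- enum (porbits pi) | touched t c]].

Definition step v t st : state :=
  ((st.1 * t)%g,
   [seq advance v t x | x <- st.2] ++ new_strands v t (st.1 * t)).

(* The transpositions are listed from the last one to the first one. *)
Fixpoint run (sigma : 'S_d) (ts : seq 'S_d) : state :=
  if ts is t :: ts' then step (size ts) t (run sigma ts')
  else (sigma, [seq (Edge 0 s.+1 #|c|, c)
                  | c : {set 'I_d} <- enum (porbits sigma)]).

Definition graph st : mgraph := map fst st.2.

Definition is_strand x := tgt x.1 == s.+1.

(** Parallel edges are equal as values of [edge]; an entry is identified by its edge together with
    its cycle, which is why these pairs have to stay distinct. *)
Definition state_ok j st :=
  [/\ perm_eq [seq x.2 | x <- st.2 & is_strand x] (enum (porbits st.1)),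
      all (fun x => wt x.1 == #|x.2|) st.2,
      staged s j (graph st) & uniq st.2].

Lemma porbits_gt0 pi (c : {set 'I_d}) : c \in porbits pi -> 0 < #|c|.
Proof. by case/imsetP=> z _ ->; rewrite lt0n card_porbit_neq0. Qed.

Lemma state_ok0 sigma : state_ok 0 (run sigma [::]).
Proof.
have pairK : cancel (fun c : {set 'I_d} => (Edge 0 s.+1 #|c|, c)) snd by [].
split=> /=.
- rewrite filter_map -map_comp (eq_map (_ : _ =1 id)) // map_id.
  by rewrite (eq_filter (_ : _ =1 xpredT)) ?filter_predT // => c /=; apply: eqxx.
- by apply/allP => _ /mapP[c _ ->] /=.
- apply/allP => _ /mapP[_ /mapP[c + ->] ->] /=; rewrite mem_enum.
  by move/porbits_gt0 => /= ->; rewrite eqxx.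
- by rewrite (map_inj_uniq (can_inj pairK)) enum_uniq.
Qed.

Lemma advance_snd v t x : (advance v t x).2 = x.2.
Proof. by rewrite /advance; case: ifP. Qed.

Lemma advance_wt v t x : wt (advance v t x).1 = wt x.1.
Proof. by rewrite /advance; case: ifP. Qed.

Lemma advance_src v t x : src (advance v t x).1 = src x.1.
Proof. by rewrite /advance; case: ifP. Qed.

Lemma advance_strand v t x : is_strand x -> touched t x.2 ->
  advance v t x = (close v x.1, x.2).
Proof. by rewrite /advance /is_strand => -> ->. Qed.

Lemma staged_mem j st x : staged s j (graph st) -> x \in st.2 ->
  [&& 0 < wt x.1, src x.1 < tgt x.1, src x.1 <= j
     & (tgt x.1 <= j) || (tgt x.1 == s.+1)].
Proof. by move=> /allP H xD; apply: H; apply: map_f. Qed.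

(** An untouched set is a cycle of [st.1] if and only if it is one of the product. So the strands
    that go on, together with the new ones, carry each cycle of the product once. *)
Lemma state_ok_step j st t : j < s -> state_ok j st ->
  state_ok j.+1 (step j.+1 t st).
Proof.
move=> js [cyc wts stg unq]; split=> /=.
- rewrite filter_cat map_cat.
  have -> : [seq x <- new_strands j.+1 t (st.1 * t) | is_strand x]
      = new_strands j.+1 t (st.1 * t).
    by apply/all_filterP/allP => _ /mapP[c _ ->]; rewrite /is_strand /= eqxx.
  have -> : [seq x.2 | x <- new_strands j.+1 t (st.1 * t)]
      = [seq c <- enum (porbits (st.1 * t)) | touched t c].
    by rewrite -map_comp; exact: map_id.
  have -> : [seq x.2 | x <- [seq advance j.+1 t x | x <- st.2] & is_strand x]
      = [seq c <- [seq x.2 | x <- st.2 & is_strand x] | ~~ touched t c].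
    elim: (st.2) => //= x D IH; rewrite {1}/is_strand {1}/advance.
    rewrite -/(is_strand x); have [xs|xs] := boolP (is_strand x) => /=.
      have [tx|tx] := boolP (touched t x.2); rewrite /= ?IH //.
        by rewrite ltn_eqF //= ltnS.
      by rewrite -/(is_strand x) xs /= IH advance_snd.
    by rewrite -/(is_strand x) (negbTE xs).
  rewrite (permPl (perm_cat (perm_filter _ cyc) (perm_refl _))).
  apply: uniq_perm; rewrite ?enum_uniq //.
    rewrite cat_uniq !(filter_uniq _ (enum_uniq _)) andbT /=.
    by apply/hasPn => c; rewrite !mem_filter => /andP[-> _].
  move=> c; rewrite mem_cat mem_filter [in X in _ || X]mem_filter !mem_enum.
  by have [tc|tc] := boolP (touched t c); rewrite ?orbF //= mem_porbits_untouched.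
- rewrite all_cat all_map /=; apply/andP; split.
    by apply: sub_all wts => x /=; rewrite advance_wt advance_snd.
  by apply/allP => _ /mapP[c _ ->] /=.
- apply/allP => _ /mapP[x + ->]; rewrite mem_cat => /orP[].
    case/mapP=> y /(staged_mem stg) + ->; rewrite advance_wt advance_src.
    by rewrite /advance; case: ifP => _ /and4P[-> h1 h2 h3] /=; lia.
  case/mapP=> c; rewrite mem_filter mem_enum => /andP[_ /porbits_gt0 c0] -> /=.
  by rewrite c0 /= eqxx; lia.
- rewrite cat_uniq; apply/and3P; split.
  + rewrite map_inj_in_uniq // => x y /(staged_mem stg) hx /(staged_mem stg) hy.
    rewrite /advance; case: ifP => [/andP[/eqP tx _]|_];
      case: ifP => [/andP[/eqP ty _]|_] // E.
    * by case: x y tx ty E {hx hy} => [[? ? ?] ?] [[? ? ?] ?] /= -> -> [-> -> ->].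
    * by move: hy; rewrite -E /=; lia.
    * by move: hx; rewrite E /=; lia.
  + apply/hasPn => _ /mapP[c _ ->]; apply/mapP => -[x /(staged_mem stg) hx].
    by move/(congr1 (fun x => src x.1)); rewrite advance_src /=; lia.
  + rewrite /new_strands map_inj_uniq => [|c c' [_ ->] //].
    exact: filter_uniq (enum_uniq _).
Qed.

Lemma run_ok sigma ts : size ts <= s -> state_ok (size ts) (run sigma ts).
Proof.
elim: ts => [_|t ts IH] /=; first exact: state_ok0.
by move=> ts_s; apply: state_ok_step => //; apply: IH; apply: ltnW.
Qed.

Lemma run_fst sigma ts :
  (run sigma ts).1 = (sigma * \prod_(t <- rev ts) t)%g.
Proof.
elim: ts => [|t ts IH] /=; first by rewrite big_nil mulg1.
by rewrite rev_cons big_rcons /= IH mulgA.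
Qed.

Lemma undo_step j st t : j < s -> state_ok j st ->
  undo s j.+1 (graph (step j.+1 t st)) = graph st.
Proof.
move=> js [_ _ stg _]; rewrite /graph /= map_cat /undo filter_cat map_cat.
set A := map _ _; set B := map _ _.
have -> : B = [::].
  rewrite /B (_ : [seq _ <- _ | _] = [::]) //; apply/eqP.
  rewrite -[_ == _]negbK -has_filter; apply/hasPn => _ /mapP[_ /mapP[c _ ->] ->].
  by rewrite negbK.
rewrite {}/A {B} cats0 -map_comp.
have : all (fun x => [&& 0 < wt x.1, src x.1 < tgt x.1, src x.1 <= j
     & (tgt x.1 <= j) || (tgt x.1 == s.+1)]) st.2.
  by apply/allP => x; apply: staged_mem.
elim: (st.2) => //= x D IH /andP[/and4P[h1 h2 h3 h4] HD].
rewrite advance_src ifT /=; last lia.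
rewrite IH //; congr (_ :: _); rewrite /advance.
case: (boolP (_ && touched _ _)) => [/andP[/eqP tx _]|_] /=.
  by rewrite eqxx closeK.
by rewrite ifF //; lia.
Qed.

Section Split.

Variables (j : nat) (st : state) (x y : 'I_d).
Hypotheses (js : j < s) (ok : state_ok j st) (xy : x != y).
Let pi := st.1.
Let t := tperm x y.
Let D' := (step j.+1 t st).2.

Lemma strand_of (z : 'I_d) :
  exists2 X, X \in st.2 & is_strand X && (X.2 == porbit pi z).
Proof.
have [cyc _ _ _] := ok.
have : porbit pi z \in [seq x.2 | x <- st.2 & is_strand x].
  by rewrite (perm_mem cyc) mem_enum imset_f.
case/mapP=> X; rewrite mem_filter => /andP[sX XD] ->.
by exists X => //; rewrite sX eqxx.
Qed.

Lemma strand_inj X R Z : perm_eq st.2 (X :: R) -> is_strand X ->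
  Z \in R -> is_strand Z -> Z.2 != X.2.
Proof.
move=> E sX ZR sZ; have [cyc _ _ _] := ok.
have : uniq [seq x.2 | x <- X :: R & is_strand x].
  rewrite -(perm_uniq (perm_map _ (perm_filter _ E))) (perm_uniq cyc).
  exact: enum_uniq.
rewrite /= sX /= => /andP[XR _]; apply: contraNneq XR => <-.
by rewrite map_f // mem_filter sZ.
Qed.

Lemma strand_cycle X z : X \in st.2 -> is_strand X -> z \in X.2 ->
  X.2 = porbit pi z.
Proof.
move=> XD sX zX; have [cyc _ _ _] := ok.
have : X.2 \in porbits pi.
  by rewrite -mem_enum -(perm_mem cyc) map_f // mem_filter sX.
by case/imsetP=> u _ eX; apply/eqP; rewrite eX eq_sym eq_porbit_mem -eX.
Qed.

Lemma advance_untouched (R : seq cycle_edge) :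
  (forall Z, Z \in R -> is_strand Z -> ~~ touched t Z.2) ->
  map (advance j.+1 t) R = R.
Proof.
move=> unt; rewrite -[RHS]map_id; apply/eq_in_map => Z ZR; rewrite /advance.
by case: ifP => // /andP[/(unt _ ZR)/negbTE ->].
Qed.

(** Distinct strands carry distinct cycles, so the transposition closes only the strands of x and y,
    and the union of their cycles is the only touched cycle of the product. *)
Lemma step_join : y \notin porbit pi x ->
  exists (X Y : cycle_edge) (R : seq cycle_edge), let c := porbit pi x :|: porbit pi y in
  [/\ perm_eq st.2 [:: X, Y & R], is_strand X /\ is_strand Y,
      X.2 = porbit pi x, Y.2 = porbit pi y
    & perm_eq D' [:: (close j.+1 X.1, X.2), (close j.+1 Y.1, Y.2),
                     (Edge j.+1 s.+1 #|c|, c) & R]].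
Proof.
move=> yx; have [_ _ _ unq] := ok.
have [X XD /andP[sX /eqP eX]] := strand_of x.
have [Y YD /andP[sY /eqP eY]] := strand_of y.
have nXY : Y != X.
  apply: contraNneq yx => YX; rewrite -eX -YX eY; exact: porbit_id.
have YD' : Y \in rem X st.2 by rewrite rem_filter // mem_filter /= nXY.
have E : perm_eq st.2 [:: X, Y & rem Y (rem X st.2)].
  rewrite (permPl (perm_to_rem XD)) perm_cons; exact: perm_to_rem.
exists X, Y, (rem Y (rem X st.2)); split=> //.
set R := rem Y _ in E *; set c := _ :|: _.
have E' : perm_eq st.2 [:: Y, X & R].
  rewrite (permPl E) (perm_catCA [:: X] [:: Y] R).
  exact: perm_refl.
have unt Z : Z \in R -> is_strand Z -> ~~ touched t Z.2.
  move=> ZR sZ; rewrite touched_tperm //.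
  have ZX : Z.2 != X.2 by apply: (strand_inj E); rewrite // inE ZR orbT.
  have ZY : Z.2 != Y.2 by apply: (strand_inj E'); rewrite // inE ZR orbT.
  have ZD : Z \in st.2 by rewrite (perm_mem E) !inE ZR !orbT.
  rewrite negb_or; apply/andP; split.
    by apply: contra ZX => /(strand_cycle ZD sZ) ->; rewrite eX.
  by apply: contra ZY => /(strand_cycle ZD sZ) ->; rewrite eY.
have N : perm_eq [seq c <- enum (porbits (pi * t)) | touched t c] [:: c].
  apply: uniq_perm; rewrite ?(filter_uniq _ (enum_uniq _)) // => b.
  rewrite mem_filter mem_enum inE touched_tperm //.
  apply/andP/eqP => [[xyb /imsetP[z _ bE]]|->]; last first.
    rewrite !inE !porbit_id; split=> //; apply/imsetP; exists x => //.
    by rewrite porbit_join // inE porbit_id.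
  have [xb|yb] := orP xyb.
    transitivity (porbit (pi * t) x); last by rewrite porbit_join ?inE ?porbit_id.
    by apply/eqP; rewrite bE eq_sym eq_porbit_mem -bE.
  transitivity (porbit (pi * t) y).
    by apply/eqP; rewrite bE eq_sym eq_porbit_mem -bE.
  by rewrite porbit_join ?inE ?porbit_id ?orbT.
rewrite /D' /= (permPl (perm_cat (perm_map _ E) (perm_refl _))) /=.
have tX : touched t X.2 by rewrite eX touched_tperm // porbit_id.
have tY : touched t Y.2 by rewrite eY touched_tperm // porbit_id orbT.
rewrite (advance_strand _ sX tX) (advance_strand _ sY tY) advance_untouched //.
rewrite eX eY.
rewrite !perm_cons perm_catC.
exact: (perm_cat (perm_map _ N) (perm_refl R)).
Qed.

Lemma step_cut a : y = (pi ^+ a)%g x -> 0 < a < #|porbit pi x| ->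
  exists (X : cycle_edge) (R : seq cycle_edge) (c c' : {set 'I_d}),
  [/\ perm_eq st.2 (X :: R), is_strand X,
      X.2 = porbit pi x, #|c| = a /\ #|c'| = #|porbit pi x| - a
    & perm_eq D' [:: (close j.+1 X.1, X.2), (Edge j.+1 s.+1 a, c),
                     (Edge j.+1 s.+1 (#|porbit pi x| - a), c') & R]].
Proof.
move=> yE an; have [_ _ _ unq] := ok.
have [X XD /andP[sX /eqP eX]] := strand_of x.
have E := perm_to_rem XD.
have [c1 c2 ncc cU] := porbit_cut an; rewrite -!yE -/t in c1 c2 ncc cU.
exists X, (rem X st.2), (porbit (pi * t) x), (porbit (pi * t) y); split=> //.
set R := rem X _ in E *.
have unt Z : Z \in R -> is_strand Z -> ~~ touched t Z.2.
  move=> ZR sZ; rewrite touched_tperm //.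
  have ZX : Z.2 != X.2 by apply: (strand_inj E).
  have ZD : Z \in st.2 by rewrite (perm_mem E) !inE ZR !orbT.
  apply: contra ZX => /orP[] /(strand_cycle ZD sZ) ->; rewrite eX //.
  by rewrite yE porbit_perm.
have N : perm_eq [seq c <- enum (porbits (pi * t)) | touched t c]
    [:: porbit (pi * t) x; porbit (pi * t) y].
  apply: uniq_perm; rewrite ?(filter_uniq _ (enum_uniq _)) //=.
    by rewrite inE andbT eq_porbit_mem porbit_sym.
  move=> b; rewrite mem_filter mem_enum !inE touched_tperm //.
  apply/andP/orP => [[xyb /imsetP[z _ bE]]|].
    by case/orP: xyb => ub; [left | right]; rewrite bE eq_sym eq_porbit_mem -bE.
  case=> /eqP ->; rewrite porbit_id ?orbT; split=> //; exact: imset_f.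
rewrite /D' /= (permPl (perm_cat (perm_map _ E) (perm_refl _))) /=.
have tX : touched t X.2 by rewrite eX touched_tperm // porbit_id.
rewrite (advance_strand _ sX tX) advance_untouched // eX.
rewrite !perm_cons perm_catC -c2 -c1.
exact: (perm_cat (perm_map _ N) (perm_refl R)).
Qed.

End Split.
End Runs.

(** * Counting the transpositions performing a move *)

Lemma card_pairs (T : finType) (P : rel T) :
  #|[set p : T * T | P p.1 p.2]| = \sum_(x : T) #|[set y | P x y]|.
Proof.
rewrite -sum1_card; under [RHS]eq_bigr => x _ do rewrite -sum1_card.
rewrite pair_big_dep /=; apply: eq_bigl => p; by rewrite !inE.
Qed.

Lemma perm_eq2 (T : eqType) (x y u v : T) :
  perm_eq [:: x; y] [:: u; v] -> (x = u /\ y = v) \/ (x = v /\ y = u).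
Proof.
move=> E; have : x \in [:: u; v] by rewrite -(perm_mem E) inE eqxx.
have P1 (a b : T) : perm_eq [:: a] [:: b] -> a = b.
  by move=> H; move/perm_mem/(_ a): H; rewrite !inE eqxx => /esym/eqP.
rewrite !inE => /orP[/eqP xu|/eqP xv].
  by left; move: E; rewrite xu perm_cons => /P1.
right; move: E; rewrite xv (perm_sym [:: _; _]) (perm_catC [:: u] [:: v]) perm_cons.
by move=> /P1.
Qed.

Section StrandEdges.

Variables (s d j : nat) (st : state d).
Hypotheses (js : j < s) (ok : state_ok s j st).
Let pi := st.1.

(** The strand on which the point z travels. The default of [head] is never reached, since the
    cycles of the strands partition the points. *)
Definition strand_edge (z : 'I_d) : edge :=
  (head (Edge 0 0 0, set0)
     [seq x <- st.2 | is_strand s x && (z \in x.2)]).1.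

Lemma strand_edgeE x z :
  x \in st.2 -> is_strand s x -> z \in x.2 -> strand_edge z = x.1.
Proof.
move=> xD sx zx; rewrite /strand_edge.
have: x \in [seq x <- st.2 | is_strand s x && (z \in x.2)].
  by rewrite mem_filter sx zx.
case E: [seq _ <- _ | _] => [//|w S] _ /=.
have : w \in [seq x <- st.2 | is_strand s x && (z \in x.2)].
  by rewrite E inE eqxx.
rewrite mem_filter -andbA => /and3P[sw zw wD].
have [-> //|wx] := eqVneq w x.
have := strand_inj ok (perm_to_rem xD) sx (_ : w \in _) sw.
rewrite rem_filter ?mem_filter /= ?wx //; last by case: ok.
by rewrite (strand_cycle ok xD sx zx) (strand_cycle ok wD sw zw) eqxx => /(_ wD).
Qed.

Lemma strand_edgeP z : exists x,
  [/\ x \in st.2, is_strand s x, x.2 = porbit pi z & strand_edge z = x.1].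
Proof.
have [x xD /andP[sx /eqP ex]] := strand_of ok z.
by exists x; split=> //; apply: strand_edgeE; rewrite // ex porbit_id.
Qed.

Lemma strand_edge_tgt z : tgt (strand_edge z) = s.+1.
Proof. by have [x [_ /eqP sx _ ->]] := strand_edgeP z. Qed.

Lemma strand_edge_wt z : wt (strand_edge z) = #|porbit pi z|.
Proof.
have [x [xD _ <- ->]] := strand_edgeP z.
by have [_ /allP/(_ x xD)/eqP] := ok.
Qed.

Lemma strand_edge_porbit u z :
  u \in porbit pi z -> strand_edge u = strand_edge z.
Proof.
by have [x [xD sx <- ->]] := strand_edgeP z; apply: strand_edgeE.
Qed.

(** Every copy of e carries a cycle with [wt e] points, and these cycles are disjoint. *)
Lemma card_strand_edge e : tgt e = s.+1 ->
  #|[set z | strand_edge z == e]| = count_mem e (graph st) * wt e.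
Proof.
move=> te; have [cyc wts _ _] := ok; rewrite -sum1_card.
rewrite (partition_big (porbit pi) (mem (porbits pi))) /=; last first.
  by move=> z _; apply: imset_f.
rewrite -big_enum /= -(perm_big _ cyc) /= big_map big_filter.
rewrite count_map -sum1_count big_distrl /= big_seq_cond [RHS]big_seq_cond.
rewrite (bigID (fun x => x.1 == e)) /= [X in _ + X]big1 ?addn0.
  apply: eq_big => [x|x /andP[/andP[xD sx] /eqP xe]].
    rewrite -andbA; congr (_ && _); rewrite /is_strand.
    by case: (x.1 =P e) => [->|]; rewrite ?andbF // te eqxx.
  rewrite sum1_card mul1n -xe (eqP (allP wts x xD)); apply: eq_card => z.
  rewrite [LHS]unfold_in /= inE; have [zx|zx] := boolP (z \in x.2).
    by rewrite (strand_edgeE xD sx zx) -(strand_cycle ok xD sx zx) xe !eqxx.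
  by apply: contraNF zx => /andP[_ /eqP <-]; apply: porbit_id.
move=> x /andP[/andP[xD sx] xe]; rewrite big1 // => z /andP[].
rewrite inE => /eqP ze /eqP zx.
by move: xe; rewrite -(strand_edgeE (z := z) xD) ?ze ?eqxx // -zx porbit_id.
Qed.

(** If z lies on a copy of e, that copy is lost. Written as a sum, the identity avoids truncated
    subtraction. *)
Lemma card_strand_edge_diff e z : tgt e = s.+1 ->
  #|[set y | (y \notin porbit pi z) && (strand_edge y == e)]|
    + (strand_edge z == e) * wt e = count_mem e (graph st) * wt e.
Proof.
move=> te; rewrite -card_strand_edge //.
rewrite -(cardsID (porbit pi z) [set y | strand_edge y == e]) addnC.
congr (_ + _); last by apply: eq_card => y; rewrite !inE.
have [ze|ze] := eqVneq (strand_edge z) e.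
  rewrite mul1n -ze strand_edge_wt; apply: eq_card => y; rewrite !inE.
  case: (boolP (y \in porbit pi z)) => [/strand_edge_porbit ->|]; last first.
    by rewrite andbF.
  by rewrite ze eqxx.
symmetry; apply/eqP; rewrite cards_eq0; apply/eqP/setP => y; rewrite !inE.
by apply: contraNF ze => /andP[/eqP <- /strand_edge_porbit ->].
Qed.

Let next t := graph (step s j.+1 t st).

Lemma next_join (x y : 'I_d) : y \notin porbit pi x ->
  exists R, let e := strand_edge x in let f := strand_edge y in
    perm_eq (graph st) [:: e, f & R]
    /\ perm_eq (next (tperm x y))
        [:: close j.+1 e, close j.+1 f, Edge j.+1 s.+1 (wt e + wt f) & R].
Proof.
move=> yx; have xy : x != y.
  by apply: contraNneq yx => <-; apply: porbit_id.
have [X [Y [R [E [sX sY] eX eY E']]]] := step_join ok xy yx.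
have XD : X \in st.2 by rewrite (perm_mem E) !inE eqxx.
have YD : Y \in st.2 by rewrite (perm_mem E) !inE eqxx orbT.
exists (map fst R).
rewrite (strand_edgeE XD) ?eX ?porbit_id // (strand_edgeE YD) ?eY ?porbit_id //.
split; first exact: (perm_map fst E).
have [_ /allP wts _ _] := ok; rewrite (eqP (wts X XD)) (eqP (wts Y YD)) eX eY.
suff <- : #|porbit pi x :|: porbit pi y| = #|porbit pi x| + #|porbit pi y|.
  exact: (perm_map fst E').
rewrite cardsU (_ : _ :&: _ = set0) ?cards0 ?subn0 //.
apply/setP => z; rewrite !inE; apply: contraNF yx => /andP[].
by rewrite -!eq_porbit_mem => /eqP <- /eqP ->.
Qed.

Lemma next_cut (x : 'I_d) a (e := strand_edge x) : 0 < a < wt e ->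
  exists R, perm_eq (graph st) (e :: R)
    /\ perm_eq (next (tperm x ((pi ^+ a)%g x)))
        [:: close j.+1 e, Edge j.+1 s.+1 a, Edge j.+1 s.+1 (wt e - a) & R].
Proof.
rewrite /e strand_edge_wt => an.
have xy : x != (pi ^+ a)%g x.
  have /andP[a0 an'] := an.
  rewrite -[X in X != _](perm1 x) -(expg0 pi) iter_inj_porbit //.
    by rewrite eq_sym -lt0n.
  exact: ltn_trans an'.
have [X [R [c [c' [E sX eX [c1 c2] E']]]]] := step_cut ok xy erefl an.
have XD : X \in st.2 by rewrite (perm_mem E) !inE eqxx.
exists (map fst R); rewrite (strand_edgeE XD) ?eX ?porbit_id //.
by split; [exact: (perm_map fst E) | exact: (perm_map fst E')].
Qed.

Lemma porbit_exp (x y : 'I_d) : y \in porbit pi x -> x != y ->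
  exists2 a, 0 < a < #|porbit pi x| & y = (pi ^+ a)%g x.
Proof.
rewrite porbit_traject => /trajectP[[|a] an ->]; rewrite -?permX.
  by rewrite expg0 perm1 eqxx.
by move=> _; exists a.+1.
Qed.

(** G is only isomorphic to the graph drawn so far because the construction continues from
    representatives. *)
Lemma next_moves t G : is_transposition t -> perm_eq (graph st) G ->
  has (iso (next t)) (moves s j.+1 G).
Proof.
case/existsP=> x /existsP[y /andP[xy /eqP ->]] EG.
have [yx|/next_join[R [E E']]] := boolP (y \in porbit pi x).
  have [a an ->] := porbit_exp yx xy; rewrite -strand_edge_wt in an.
  have [R [E E']] := next_cut an.
  apply: (has_iso_cut _ (strand_edge_tgt x) an E').
  by rewrite -(permPl EG).
apply: (has_iso_join _ (strand_edge_tgt x) (strand_edge_tgt y) E').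
by rewrite -(permPl EG).
Qed.

Lemma edge_inj e f : (src e, wt e) = (src f, wt f) -> tgt e = tgt f -> e = f.
Proof. by case: e f => ? ? ? [? ? ?] /= [-> ->] ->. Qed.

Lemma fresh_count v c R : fresh v R -> (src c == v) || (tgt c == v) ->
  count_mem c R = 0.
Proof.
move=> /allP HR hc; apply/count_memPn/negP => /HR /andP[/negbTE h1 /negbTE h2].
by rewrite h1 h2 in hc.
Qed.

Lemma closing_join e f R : fresh j.+1 R ->
  closing j.+1 [:: close j.+1 e, close j.+1 f,
                   Edge j.+1 s.+1 (wt e + wt f) & R]
  = [:: (src e, wt e); (src f, wt f)].
Proof.
by move=> HR; rewrite !closing_cons /= !eqxx eqSS gtn_eqF // closing_fresh.
Qed.

Lemma closing_cut e a R : fresh j.+1 R ->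
  closing j.+1 [:: close j.+1 e, Edge j.+1 s.+1 a,
                   Edge j.+1 s.+1 (wt e - a) & R]
  = [:: (src e, wt e)].
Proof.
by move=> HR; rewrite !closing_cons /= !eqxx eqSS gtn_eqF // closing_fresh.
Qed.

Lemma opening_cut e a R : src e != j.+1 -> fresh j.+1 R ->
  opening j.+1 [:: close j.+1 e, Edge j.+1 s.+1 a,
                   Edge j.+1 s.+1 (wt e - a) & R]
  = [:: a; wt e - a].
Proof.
by move=> /negbTE he HR; rewrite !opening_cons /= he !eqxx opening_fresh.
Qed.

Lemma graph_fresh G : perm_eq (graph st) G -> fresh j.+1 G.
Proof.
move=> EG; rewrite /fresh -(perm_all _ EG); apply: (staged_fresh js).
by case: ok.
Qed.

(** There are [wt e * wt f] ordered pairs for each choice of a copy of e and another strand equal to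
    f, and the number of choices is the quotient of [nb_sym G] by [nb_sym R]. If e = f, every
    transposition arises from two pairs; then the two closed edges of H are equal, so [nb_sym H] has
    the same factor two. *)
Lemma count_join G e f R : perm_eq (graph st) G -> perm_eq G [:: e, f & R] ->
  tgt e = s.+1 -> tgt f = s.+1 ->
  let H := [:: close j.+1 e, close j.+1 f, Edge j.+1 s.+1 (wt e + wt f) & R] in
  #|[set t | is_transposition t && iso (next t) H]| * nb_sym H
    = nb_sym G * vertex_weight H j.+1.
Proof.
move=> EG GE te tf H; have E0 := perm_trans EG GE.
have /and3P[/andP[he1 he2] /andP[hf1 hf2] HR] := graph_fresh E0.
rewrite -/(fresh _ _) in HR.
pose P x y := (strand_edge x == e)
  && ((y \notin porbit pi x) && (strand_edge y == f)).
have Pneq x y : P x y -> x != y.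
  by case/and3P=> _ + _; apply: contraNneq => ->; apply: porbit_id.
have PQ x y : P x y -> iso (next (tperm x y)) H.
  case/and3P=> /eqP ex yx /eqP fy.
  have [R' [E E']] := next_join yx; rewrite ex fy in E E'.
  rewrite /iso (permPl E') !perm_cons.
  by move: E; rewrite (permPl E0) !perm_cons perm_sym.
have Pspec x y : x != y -> iso (next (tperm x y)) H = P x y || P y x.
  move=> xy; apply/idP/orP => [Q|[|]]; [|exact: PQ|by rewrite tpermC; exact: PQ].
  have [yx|yx] := boolP (y \in porbit pi x).
    have [a an yE] := porbit_exp yx xy; rewrite -strand_edge_wt in an.
    have [R' [E E']] := next_cut an; rewrite -yE in E'.
    have /andP[_ HR'] := graph_fresh E.
    (* A cut closes one strand at [j.+1] where a join closes two. *)
    move: (perm_closing j.+1 Q); rewrite (permPl (perm_closing j.+1 E')).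
    by rewrite closing_cut // closing_join // => /perm_size.
  have [R' [E E']] := next_join yx.
  have /and3P[_ _ HR'] := graph_fresh E.
  move: (perm_closing j.+1 Q); rewrite (permPl (perm_closing j.+1 E')).
  rewrite !closing_join // => /perm_eq2[] [/edge_inj ex /edge_inj fy].
    by left; rewrite /P ex ?te ?strand_edge_tgt // fy ?tf ?strand_edge_tgt //
      yx !eqxx.
  by right; rewrite /P ex ?tf ?strand_edge_tgt // fy ?te ?strand_edge_tgt //
    porbit_sym yx !eqxx.
have Psym x y : P x y -> P y x = (e == f).
  case/and3P=> /eqP ex yx /eqP fy; rewrite /P ex fy porbit_sym yx /= andbC.
  by rewrite eq_sym andbb.
have := @card_transpositions d P (fun t => iso (next t) H) _ Pneq Pspec Psym.
set N := #|_| => card_N.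
have cardP : #|[set p : 'I_d * 'I_d | P p.1 p.2]|
    = (count_mem e (f :: R)).+1 * wt e * ((count_mem f R).+1 * wt f).
  rewrite card_pairs (bigID (fun x => strand_edge x == e)) /= addnC big1.
    rewrite add0n (eq_bigr (fun=> (count_mem f R).+1 * wt f)) => [|x /eqP ex].
      rewrite sum_nat_const; congr (_ * _).
      have := card_strand_edge te; rewrite (seq.permP E0) /= eqxx add1n => <-.
      by apply: eq_card => x; rewrite !inE.
    (* The strand of x is itself a copy of f exactly when e = f; this contribution occurs on both
       sides and cancels. *)
    have := card_strand_edge_diff x tf; rewrite (seq.permP E0) /= eqxx ex.
    rewrite mulnDl addnC => /addnI; rewrite add1n => <-.
    by apply: eq_card => y; rewrite !inE /P ex eqxx.
  move=> x /negbTE ex; apply/eqP; rewrite cards_eq0; apply/eqP/setP => y.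
  by rewrite !inE /P ex.
have symH : nb_sym H = (e == f).+1 * nb_sym R.
  rewrite /H /= !(fresh_count HR) /= ?eqxx ?orbT // !addn0 !mul1n.
  have -> : (close j.+1 f == close j.+1 e) = (e == f).
    apply/eqP/eqP => [[hs hw]|-> //].
    by apply: edge_inj; rewrite ?hs ?hw ?te ?tf.
  have newF g : src g != j.+1 ->
      (Edge j.+1 s.+1 (wt e + wt f) == close j.+1 g) = false.
    by move=> hg; apply: contraNF hg => /eqP[<-].
  by rewrite !newF // !addn0 mul1n.
have weightH : vertex_weight H j.+1 = wt e * wt f.
  by rewrite vertex_weightE closing_join // !big_cons big_nil muln1.
rewrite symH mulnA card_N cardP weightH (nb_sym_perm GE) /=.
by rewrite -!mulnA; nia.
Qed.

(** Here x is any point on a copy of e, and y is forced to lie a steps after it. Exchanging x and y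
    performs the same cut if and only if the pieces have equal size, and then the two new strands of
    H are equal. *)
Lemma count_cut G e a R : perm_eq (graph st) G -> perm_eq G (e :: R) ->
  tgt e = s.+1 -> 0 < a < wt e ->
  let H := [:: close j.+1 e, Edge j.+1 s.+1 a, Edge j.+1 s.+1 (wt e - a) & R] in
  #|[set t | is_transposition t && iso (next t) H]| * nb_sym H
    = nb_sym G * vertex_weight H j.+1.
Proof.
move=> EG GE te ae H; have E0 := perm_trans EG GE.
have /andP[/andP[he1 he2] HR] := graph_fresh E0.
rewrite -/(fresh _ _) in HR.
pose P x y := (strand_edge x == e) && (y == (pi ^+ a)%g x).
have Pneq x y : P x y -> x != y.
  case/andP=> /eqP ex /eqP ->; have /andP[a0 an] := ae.
  rewrite -ex strand_edge_wt in an.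
  rewrite -[X in X != _](perm1 x) -(expg0 pi) iter_inj_porbit //.
    by rewrite eq_sym -lt0n.
  exact: ltn_trans an.
have PQ x y : P x y -> iso (next (tperm x y)) H.
  case/andP=> /eqP ex /eqP ->.
  have := @next_cut x a; rewrite /= ex => /(_ ae)[R' [E E']].
  rewrite /iso (permPl E') !perm_cons.
  by move: E; rewrite (permPl E0) !perm_cons perm_sym.
have Pspec x y : x != y -> iso (next (tperm x y)) H = P x y || P y x.
  move=> xy; apply/idP/orP => [Q|[|]]; [|exact: PQ|by rewrite tpermC; exact: PQ].
  have [yx|yx] := boolP (y \in porbit pi x); last first.
    have [R' [E E']] := next_join yx.
    have /and3P[_ _ HR'] := graph_fresh E.
    move: (perm_closing j.+1 Q); rewrite (permPl (perm_closing j.+1 E')).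
    by rewrite closing_cut // closing_join // => /perm_size.
  have [b bn yE] := porbit_exp yx xy.
  have bn' := bn; rewrite -strand_edge_wt in bn'.
  have [R' [E E']] := next_cut bn'; rewrite -yE in E'.
  have /andP[/andP[hx _] HR'] := graph_fresh E.
  move: (perm_closing j.+1 Q); rewrite (permPl (perm_closing j.+1 E')).
  rewrite !closing_cut // => /perm_mem/(_ (src e, wt e)).
  rewrite !inE eqxx => /eqP/esym/edge_inj ex.
  have {}ex : strand_edge x = e by apply: ex; rewrite te strand_edge_tgt.
  move: (perm_opening j.+1 Q); rewrite (permPl (perm_opening j.+1 E')).
  rewrite !opening_cut // ex => /perm_eq2[] [ba _]; [left | right].
    by rewrite /P ex yE ba !eqxx.
  (* The pieces come in the other order, [b = wt e - a]: going a steps beyond y leads round the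
     cycle to x. *)
  rewrite /P (strand_edge_porbit yx) ex eqxx /= yE -permM -expgD ba.
  rewrite subnK; last by case/andP: ae => _ /ltnW.
  by rewrite -ex strand_edge_wt permX iter_porbit.
have Psym x y : P x y -> P y x = (a == wt e - a).
  case/andP=> /eqP ex /eqP ->; rewrite /P.
  rewrite (strand_edge_porbit (mem_porbit _ _ _)) ex eqxx /=.
  have en : wt e = #|porbit pi x| by rewrite -ex strand_edge_wt.
  set u := (pi ^+ a)%g x; have /andP[a0 an] := ae.
  have xE : x = (pi ^+ (wt e - a))%g u.
    by rewrite /u -permM -expgD subnKC ?en ?permX ?iter_porbit // -en ltnW.
  have cu : #|porbit pi u| = wt e by rewrite porbit_perm -en.
  by rewrite [in LHS]xE eq_sym iter_inj_porbit // cu // -subn_gt0 subKn // ltnW.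
have := @card_transpositions d P (fun t => iso (next t) H) _ Pneq Pspec Psym.
set N := #|_| => card_N.
have cardP : #|[set p : 'I_d * 'I_d | P p.1 p.2]| = (count_mem e R).+1 * wt e.
  rewrite card_pairs (bigID (fun x => strand_edge x == e)) /= addnC big1.
    rewrite add0n (eq_bigr (fun=> 1)) => [|x /eqP ex].
      rewrite sum1_card.
      have := card_strand_edge te; rewrite (seq.permP E0) /= eqxx add1n => <-.
      by apply: eq_card => x; rewrite !inE.
    rewrite -(cards1 ((pi ^+ a)%g x)).
    by apply: eq_card => y; rewrite !inE /P ex eqxx.
  move=> x /negbTE ex; apply/eqP; rewrite cards_eq0; apply/eqP/setP => y.
  by rewrite !inE /P ex.
have symH : nb_sym H = (a == wt e - a).+1 * nb_sym R.
  rewrite /H /= !(fresh_count HR) /= ?eqxx ?orbT // !addn0 !mul1n.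
  have newF b : (Edge j.+1 s.+1 b == close j.+1 e) = false.
    by apply: contraNF he1 => /eqP[<-].
  rewrite !newF mul1n; congr (_.+1 * _).
  by congr nat_of_bool; apply/eqP/eqP => [[->]|<-].
have weightH : vertex_weight H j.+1 = wt e.
  by rewrite vertex_weightE closing_cut // big_cons big_nil muln1.
rewrite symH mulnA card_N cardP weightH (nb_sym_perm GE) /=.
by rewrite mulnAC.
Qed.

Lemma count_moves G H : perm_eq (graph st) G -> H \in moves s j.+1 G ->
  #|[set t | is_transposition t && iso (next t) H]| * nb_sym H
    = nb_sym G * vertex_weight H j.+1.
Proof.
move=> EG /join_or_cut[[e [f [R [GE te tf _ ->]]]]|[e [a [R [GE te ae ->]]]]].
  exact: count_join.
exact: count_cut.
Qed.

End StrandEdges.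

(** * Counting the tuples drawing a graph *)

Section CountRuns.

Variables (s d : nat) (eta : seq nat).
Implicit Types (G H : mgraph) (i : nat).

Definition tuple_run i (r : 'S_d * i.-tuple 'S_d) : state d := run s r.1 r.2.

Definition valid_run i (r : 'S_d * i.-tuple 'S_d) : bool :=
  has_cycle_type r.1 eta && all (@is_transposition d) r.2.

Definition nb_runs i G :=
  #|[set r : 'S_d * i.-tuple 'S_d | valid_run r && iso (graph (tuple_run r)) G]|.

Lemma tuple_run_ok i (r : 'S_d * i.-tuple 'S_d) : i <= s ->
  state_ok s i (tuple_run r).
Proof.
by move=> si; have := @run_ok s d r.1 r.2; rewrite size_tuple; apply.
Qed.

Lemma tuple_run_cons i (r : 'S_d * i.-tuple 'S_d) t :
  tuple_run (r.1, [tuple of t :: r.2]) = step s i.+1 t (tuple_run r).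
Proof. by rewrite /tuple_run /= size_tuple. Qed.

Lemma nb_runsS i H : nb_runs i.+1 H =
  \sum_(r : 'S_d * i.-tuple 'S_d | valid_run r)
    #|[set t | is_transposition t && iso (graph (step s i.+1 t (tuple_run r))) H]|.
Proof.
rewrite /nb_runs -sum1_card.
pose f (p : ('S_d * i.-tuple 'S_d) * 'S_d) : 'S_d * i.+1.-tuple 'S_d :=
  (p.1.1, [tuple of p.2 :: p.1.2]).
pose g (r : 'S_d * i.+1.-tuple 'S_d) : ('S_d * i.-tuple 'S_d) * 'S_d :=
  ((r.1, [tuple of behead r.2]), thead r.2).
rewrite (reindex f) /=; last first.
  exists g => [[[a u] t]|[a u]] _; rewrite /f /g /=.
    by congr (_, _, _); apply: val_inj.
  by congr (_, _); rewrite [RHS]tuple_eta.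
under [RHS]eq_bigr => r _ do rewrite -sum1_card.
rewrite [RHS]pair_big_dep /=; apply: eq_bigl => -[r t].
rewrite !inE /f tuple_run_cons /valid_run /=; set x := iso _ _.
by case: (has_cycle_type _ _); case: (is_transposition _); case: (all _ _).
Qed.

Lemma partial_graphsS i H : H \in partial_graphs s eta i.+1 ->
  exists2 G, G \in partial_graphs s eta i & H \in moves s i.+1 G.
Proof. by move=> /iso_reps_subset/flatten_mapP[G]; exists G. Qed.

Lemma staged_partial i G : is_partition d eta -> i <= s ->
  G \in partial_graphs s eta i -> staged s i G.
Proof.
case/and3P=> _ /allP eta0 _; elim: i G => [|i IH] G si.
  rewrite inE => /eqP ->; apply/allP => _ /mapP[n /eta0 n0 ->] /=.
  by rewrite n0 eqxx.
by case/partial_graphsS=> G' /(IH _ (ltnW si)) stG; exact: staged_moves.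
Qed.

Lemma vertex_weight_moves i G H v : i < s -> staged s i G ->
  H \in moves s i.+1 G -> v <= i -> vertex_weight H v = vertex_weight G v.
Proof.
move=> si stG HG vi; rewrite !vertex_weightE.
have lt1 : (i.+1 == v) = false by lia.
have lt2 : (s.+1 == v) = false by lia.
case/join_or_cut: HG=> [[e [f [R [GE te tf _ ->]]]]|[e [a [R [GE te ae ->]]]]];
  rewrite [RHS](perm_big _ (perm_closing v GE)) !closing_cons /= te ?tf.
  by rewrite lt1 lt2.
by rewrite lt1 lt2.
Qed.

(** By [undo], a run drawing H must have drawn G one transposition earlier; hence only one
    predecessor contributes to the count for H. *)
Lemma iso_step i (r : 'S_d * i.-tuple 'S_d) G H t : i < s -> staged s i G ->
  H \in moves s i.+1 G -> iso (graph (step s i.+1 t (tuple_run r))) H ->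
  iso (graph (tuple_run r)) G.
Proof.
move=> si stG HG /(perm_undo s i.+1).
rewrite (undo_step _ si (tuple_run_ok r (ltnW si))) => E.
exact: perm_trans E (undo_moves si stG HG).
Qed.

Lemma graph_run0 (sigma : 'S_d) : graph (run s sigma [::])
  = start s [seq #|(c : {set 'I_d})| | c <- enum (porbits sigma)].
Proof. by rewrite /graph /start /= -!map_comp. Qed.

Lemma nb_runs0 : nb_runs 0 (start s eta) = epsilon d eta.
Proof.
rewrite /nb_runs /epsilon.
rewrite -(card_imset _ (_ : injective (fun a : 'S_d => (a, [tuple] : 0.-tuple 'S_d)))).
  apply: eq_card => -[a u]; rewrite !inE /valid_run /=.
  apply/idP/imsetP => [/andP[/andP[ha _] _]|[b]].
    by exists a; rewrite ?inE // (tuple0 u).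
  rewrite inE => hb [-> ->]; rewrite hb /= /tuple_run graph_run0 /iso.
  exact: perm_map hb.
by move=> a b [].
Qed.

Lemma nb_runsE i G : is_partition d eta -> i <= s ->
  G \in partial_graphs s eta i ->
  nb_runs i G * nb_sym G = epsilon d eta * aut_size eta
    * \prod_(1 <= v < i.+1) vertex_weight G v.
Proof.
move=> heta; elim: i G => [|i IH] H si.
  rewrite inE => /eqP ->; rewrite nb_runs0 big_geq // muln1 aut_sizeE.
  by rewrite /start nb_sym_map_inj // => m n [].
case/partial_graphsS=> G HG HM; have stG := staged_partial heta (ltnW si) HG.
rewrite big_nat_recr //= nb_runsS (bigID (fun r => iso (graph (tuple_run r)) G)).
rewrite /= [X in _ + X]big1 ?addn0; last first.
  move=> r /andP[_ nG]; apply/eqP; rewrite cards_eq0; apply/eqP/setP => t.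
  rewrite !inE; apply: contraNF nG => /andP[_]; exact: iso_step.
rewrite big_distrl /=.
rewrite (eq_bigr (fun=> nb_sym G * vertex_weight H i.+1)); last first.
  move=> r /andP[_ rG]; apply: count_moves => //.
  exact: tuple_run_ok (ltnW si).
rewrite sum_nat_const mulnA -[X in X * _ * _]/(#|_|).
rewrite (_ : #|_| = nb_runs i G); last first.
  by apply: eq_card => r; rewrite !inE.
rewrite IH ?(ltnW si) // -!mulnA; congr (_ * (_ * (_ * _))).
apply: eq_big_nat => v /andP[_ vi]; symmetry.
exact: vertex_weight_moves HM _.
Qed.

Lemma has_partial_graph i (r : 'S_d * i.-tuple 'S_d) : i <= s -> valid_run r ->
  has (iso (graph (tuple_run r))) (partial_graphs s eta i).
Proof.
elim: i r => [|i IH] [a u] si /andP[/= ha hu].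
  by rewrite /tuple_run /= (tuple0 u) graph_run0 /iso perm_map.
case/tupleP: u hu => t u /= /andP[ht hu].
have vr : valid_run (a, u) by rewrite /valid_run /= ha.
have /hasP[G GP EG] := IH (a, u) (ltnW si) vr.
rewrite (tuple_run_cons (a, u)).
have := next_moves (tuple_run_ok (a, u) (ltnW si)) ht EG.
case/hasP=> H HG HE.
have /has_iso_reps/hasP[K KP HK] :
    H \in flatten [seq moves s i.+1 G | G <- partial_graphs s eta i].
  by apply/flatten_mapP; exists G.
by apply/hasP; exists K => //; apply: perm_trans HE HK.
Qed.

Lemma count_partial_graphs i G : count (iso G) (partial_graphs s eta i) <= 1.
Proof.
case: i => [|i]; last exact: count_iso_reps.
by rewrite /= addn0 leq_b1.
Qed.

(** By [has_partial_graph] and [count_partial_graphs] a valid run draws exactly one of the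
    representatives, so exchanging the sums counts it once. *)
Lemma card_runs (C : pred mgraph) i : i <= s ->
  (forall G H, iso G H -> C G = C H) ->
  #|[set r : 'S_d * i.-tuple 'S_d | valid_run r && C (graph (tuple_run r))]|
  = \sum_(G <- partial_graphs s eta i | C G) nb_runs i G.
Proof.
move=> si CE.
under [RHS]eq_bigr => G _ do rewrite /nb_runs -sum1_card big_mkcond.
rewrite exchange_big /= -sum1_card big_mkcond; apply: eq_bigr => r _.
rewrite inE; case vr: (valid_run r) => /=; last first.
  by rewrite big1 // => G _; rewrite inE vr.
rewrite -big_mkcondr /= (eq_bigl (fun G =>
  C (graph (tuple_run r)) && iso (graph (tuple_run r)) G)); last first.
  move=> G; rewrite inE vr /=; case E: (iso _ _); rewrite ?andbF //.
  by rewrite (CE _ _ E).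
case: (C _); rewrite /= ?big_pred0_eq // sum1_count.
apply/esym/eqP; rewrite eqn_leq count_partial_graphs -has_count.
exact: has_partial_graph.
Qed.

End CountRuns.

(** * Connectedness and transitivity *)

(** Serves to carry a colouring of the edges along an isomorphism of graphs. *)
Lemma perm_map_lift (T U : eqType) (f : T -> U) (s : seq T) (t : seq U) :
  perm_eq (map f s) t -> exists2 s', perm_eq s s' & map f s' = t.
Proof.
case: s => [|x0 s]; first by rewrite perm_sym => /perm_nilP ->; exists [::].
move: (x0 :: s) => {}s; rewrite perm_sym => /(perm_iotaP (f x0)).
rewrite size_map => -[Is IsE ->]; exists (map (nth x0 s) Is).
  by rewrite perm_sym -[X in perm_eq _ X](mkseq_nth x0 s); apply: perm_map.
rewrite -map_comp; apply/eq_in_map => i; rewrite (perm_mem IsE) mem_iota => /= lti.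
by rewrite (nth_map x0).
Qed.

Section Connected.

Variable s : nat.
Implicit Types (G H : mgraph).

Lemma adjacent_sym e f : adjacent s e f = adjacent s f e.
Proof. by rewrite /adjacent; apply: eq_has => v; rewrite andbC. Qed.

(** Colours belong to occurrences rather than to values of [edge]: two equal edges from 0 to s+1
    form a disconnected graph and must be allowed different colours. *)
Definition compatible (D : seq (edge * bool)) :=
  forall x y, x \in D -> y \in D -> adjacent s x.1 y.1 -> x.2 = y.2.

Lemma connected_colouring G : connected s G <->
  forall D, map fst D = G -> compatible D ->
    forall x y, x \in D -> y \in D -> x.2 = y.2.
Proof.
split=> [/forallP HG D DG cD x y xD yD|HG].
  pose c (i : 'I_(size G)) := (nth x D i).2.
  have szD : size G = size D by rewrite -DG size_map.
  have nE (i : 'I_(size G)) : tnth (in_tuple G) i = (nth x D i).1.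
    by rewrite (tnth_nth x.1) /= -(nth_map x x.1) -?szD // DG.
  have cE (i j : 'I_(size G)) :
      connect (fun i j : 'I_(size G) =>
        adjacent s (tnth (in_tuple G) i) (tnth (in_tuple G) j)) i j -> c i = c j.
    case/connectP=> p; elim: p i => /= [|k p IH] i; first by move=> _ ->.
    case/andP=> ik kp jE; rewrite -(IH k) //; apply: cD; rewrite ?mem_nth -?szD //.
    by rewrite -!nE.
  have ix : index x D < size G by rewrite szD index_mem.
  have iy : index y D < size G by rewrite szD index_mem.
  have /forallP/(_ (Ordinal iy))/cE := HG (Ordinal ix).
  by rewrite /c /= !nth_index.
apply/forallP => i; apply/forallP => j; set adj := (X in connect X).
(* The colour records whether an edge can be reached from edge i. *)
pose D := [seq (tnth (in_tuple G) k, connect adj i k) | k <- enum 'I_(size G)].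
have DG : map fst D = G.
  by rewrite -map_comp map_tnth_enum.
have cD : compatible D.
  move=> _ _ /mapP[k _ ->] /mapP[l _ ->] /= kl.
  apply/idP/idP => h; apply: connect_trans h _; apply: connect1 => //.
  by rewrite /adj adjacent_sym.
have mD k : (tnth (in_tuple G) k, connect adj i k) \in D.
  by apply/mapP; exists k; rewrite ?mem_enum.
by have := HG D DG cD _ _ (mD i) (mD j); rewrite /= connect0 => <-.
Qed.

Lemma connected_iso G H : iso G H -> connected s G = connected s H.
Proof.
suff imp G' H' : iso G' H' -> connected s G' -> connected s H'.
  by move=> GH; apply/idP/idP; apply: imp; rewrite // /iso perm_sym.
move=> GH /connected_colouring cG; apply/connected_colouring => D DH cD x y xD yD.
have [|D' DD' D'G] := @perm_map_lift _ _ fst D G'.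
  by rewrite DH perm_sym.
have mD : D' =i D by move=> z; rewrite (perm_mem DD').
by apply: (cG D') => //; rewrite ?mD // => u v; rewrite !mD; apply: cD.
Qed.

End Connected.

Section InvariantSets.

Variable d : nat.
Implicit Types (B : {set 'I_d}) (p t : 'S_d).

Definition invariant_set B p := forall z, (p z \in B) = (z \in B).

Lemma invariant_setM B p q :
  invariant_set B p -> invariant_set B q -> invariant_set B (p * q).
Proof. by move=> hp hq z; rewrite permM hq. Qed.

Lemma invariant_setV B p : invariant_set B p -> invariant_set B p^-1.
Proof. by move=> hp z; rewrite -hp permKV. Qed.

Lemma invariant_porbit B p c z u : invariant_set B p -> c \in porbits p ->
  z \in c -> u \in c -> (z \in B) = (u \in B).
Proof.
move=> hp /imsetP[w _ ->].
have E v : v \in porbit p w -> (v \in B) = (w \in B).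
  case/porbitP=> i ->; elim: i => [|i IH]; first by rewrite expg0 perm1.
  by rewrite expgSr permM hp.
by move=> /E -> /E ->.
Qed.

(** For the converse, the orbit of a point is invariant and non-empty, hence everything. *)
Lemma transitive_invariant (A : {set 'S_d}) : 0 < d ->
  [transitive <<A>>%g, on [set: 'I_d] | 'P] <->
  forall B, (forall a, a \in A -> invariant_set B a) -> B = set0 \/ B = setT.
Proof.
move=> d0; pose z0 := Ordinal d0; split=> [trA B AB|HA].
  have [->|[z zB]] := set_0Vmem B; first by left.
  right; apply/setP => u; rewrite inE.
  have [g gA ->] := atransP2 trA (in_setT z) (in_setT u).
  have AN : (<<A>> \subset 'N(B | 'P))%g.
    rewrite gen_subG; apply/subsetP => a aA; apply/astabsP; rewrite ?inE //.
    by move=> v; apply: (AB a aA).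
  by rewrite (astabsP (subsetP AN g gA)).
apply/imsetP; exists z0; rewrite ?inE //.
have HB a : a \in A -> invariant_set (orbit 'P <<A>>%g z0) a.
  by move=> aA z; rewrite -[a z]/('P%act z a) orbit_actr // mem_gen.
by case: (HA _ HB) => [/setP/(_ z0)|-> //]; rewrite inE orbit_refl.
Qed.

End InvariantSets.

Section RunConnected.

Variables s d : nat.
Implicit Types (B : {set 'I_d}) (sigma t : 'S_d) (ts : seq 'S_d)
  (x y : cycle_edge d).

Lemma mem_run_cons sigma t ts x : x \in (run s sigma (t :: ts)).2 ->
  (exists2 y, y \in (run s sigma ts).2 & x = advance s (size ts).+1 t y)
  \/ (exists c, [/\ c \in porbits (run s sigma (t :: ts)).1, touched t c
                 & x = (Edge (size ts).+1 s.+1 #|c|, c)]).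
Proof.
rewrite /= mem_cat => /orP[/mapP[y yD ->]|/mapP[c]]; first by left; exists y.
by rewrite mem_filter mem_enum => /andP[tc cp] ->; right; exists c.
Qed.

(** As [ts] starts with the last transposition, the one at vertex v has index [size ts - v]. An edge
    meets v only by being closed or created there, and in both cases its cycle is touched. *)
Lemma incident_touched sigma ts x v : size ts <= s ->
  x \in (run s sigma ts).2 -> 0 < v <= size ts -> incident v x.1 ->
  touched (nth 1%g ts (size ts - v)) x.2.
Proof.
elim: ts x => [|t ts IH] x ss; first by case: v.
have ss' : size ts < s := ss; have [_ _ stg _] := run_ok sigma (ltnW ss').
case/mem_run_cons=> [[y yD ->]|[c [_ tc ->]]] /andP[v0] /=; rewrite leq_eqVlt.
  have /and4P[_ h1 h2 h3] := staged_mem stg yD.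
  case/orP=> [/eqP ->|vs].
    rewrite subnn /= advance_snd /incident advance_src /advance.
    by case: ifP => [/andP[] //|_ iv]; exfalso; lia.
  rewrite subSn //= advance_snd => iv; apply: IH => //; first exact: ltnW.
    by rewrite v0.
  move: iv; rewrite /incident advance_src /advance.
  by case: ifP => //= _ /orP[->//|]; lia.
case/orP=> [/eqP ->|vs]; first by rewrite subnn.
by rewrite /incident /= => iv; exfalso; lia.
Qed.

Lemma run_invariant sigma ts B : invariant_set B sigma ->
  (forall t, t \in ts -> invariant_set B t) -> invariant_set B (run s sigma ts).1.
Proof.
move=> Bs; elim: ts => //= t ts IH Bt; apply: invariant_setM.
  by apply: IH => u uts; apply: Bt; rewrite inE uts orbT.
by apply: Bt; rewrite inE eqxx.
Qed.

(** The cycle of an entry is a cycle of some partial product, which preserves B. *)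
Lemma run_entry_invariant sigma ts B x z u : invariant_set B sigma ->
  (forall t, t \in ts -> invariant_set B t) -> x \in (run s sigma ts).2 ->
  z \in x.2 -> u \in x.2 -> (z \in B) = (u \in B).
Proof.
move=> Bs; elim: ts x => [|t ts IH] x Bt.
  by case/mapP=> c; rewrite mem_enum => cp ->; apply: invariant_porbit cp.
case/mem_run_cons=> [[y yD ->]|[c [cp _ ->]]].
  by rewrite advance_snd; apply: IH => // w wts; apply: Bt; rewrite inE wts orbT.
exact: invariant_porbit (run_invariant Bs Bt) cp.
Qed.

Definition compatible_entries (chi : cycle_edge d -> bool)
    (D : seq (cycle_edge d)) :=
  forall x y, x \in D -> y \in D -> adjacent s x.1 y.1 -> chi x = chi y.

Lemma adjacent_at v e f : 0 < v <= s -> incident v e -> incident v f ->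
  adjacent s e f.
Proof.
by move=> hv he hf; apply/hasP; exists v; rewrite ?he // mem_iota add1n ltnS.
Qed.

(** By induction on [ts], the colouring pulled back along [advance] yields B. The last transposition
    preserves B because the strands of its two points meet at the new vertex and so have one colour;
    a new strand meets an old one there as well. *)
Lemma colouring_invariant sigma ts chi : size ts <= s ->
  compatible_entries chi (run s sigma ts).2 ->
  exists B, [/\ invariant_set B sigma, forall t, t \in ts -> invariant_set B t
    & forall x z, x \in (run s sigma ts).2 -> z \in x.2 -> chi x = (z \in B)].
Proof.
elim: ts chi => [|t ts IH] chi ss cchi.
  pose D := (run s sigma [::]).2.
  pose entry z := (Edge 0 s.+1 #|porbit sigma z|, porbit sigma z) : cycle_edge d.
  exists [set z | chi (entry z)]; split=> // [z|x z /mapP[c + ->] /= zc].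
    suff E : porbit sigma (sigma z) = porbit sigma z by rewrite !inE /entry E.
    by apply/eqP; rewrite eq_porbit_mem mem_porbit_step porbit_id.
  rewrite mem_enum inE /entry => /imsetP[w _ cE]; suff -> : c = porbit sigma z by [].
  by apply/eqP; rewrite cE eq_sym eq_porbit_mem -cE.
have ss' : size ts < s := ss.
have ok := run_ok sigma (ltnW ss'); have [_ _ stg _] := ok.
set v := (size ts).+1; have vs : 0 < v <= s by [].
pose adv := advance s v t.
have advD y : y \in (run s sigma ts).2 -> adv y \in (run s sigma (t :: ts)).2.
  by move=> yD; rewrite /= mem_cat map_f.
have [x y xD yD /hasP[w]|B [Bs Bts chiB]] := IH (chi \o adv) (ltnW ss).
  rewrite mem_iota => hw /andP[wx wy]; apply: cchi; rewrite ?advD //.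
  (* Closing a strand loses only its incidence with [s.+1], which is not a vertex, so adjacent edges
     stay adjacent. *)
  suff advI z : z \in (run s sigma ts).2 -> incident w z.1 -> incident w (adv z).1.
    by apply/hasP; exists w; rewrite ?mem_iota // !advI.
  move=> /(staged_mem stg) hz; rewrite /incident /adv advance_src /advance.
  by case: ifP => // /andP[/eqP tz _] /=; case/orP=> [->|] //; lia.
have Bt : invariant_set B t.
  move=> z; have [->//|tz] := eqVneq (t z) z.
  have [X XD /andP[sX /eqP eX]] := strand_of ok z.
  have [Y YD /andP[sY /eqP eY]] := strand_of ok (t z).
  rewrite -(chiB X z) // ?eX ?porbit_id // -(chiB Y (t z)) // ?eY ?porbit_id //=.
  have tX : touched t X.2.
    by apply/existsP; exists z; rewrite eX porbit_id.
  have tY : touched t Y.2.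
    by apply/existsP; exists (t z); rewrite eY porbit_id (inj_eq perm_inj).
  apply: cchi; rewrite ?advD //; apply: (adjacent_at vs); rewrite /adv.
    by rewrite (advance_strand _ sY tY) /incident /= eqxx orbT.
  by rewrite (advance_strand _ sX tX) /incident /= eqxx orbT.
have Bts' w : w \in t :: ts -> invariant_set B w.
  by rewrite inE => /orP[/eqP -> //|]; apply: Bts.
exists B; split=> // x z /mem_run_cons[[y yD ->]|[c [cp tc ->]]] /= zc.
  by rewrite advance_snd in zc; rewrite -(chiB y z).
(* Membership in B is constant on c, so it may be tested at a moved point u, whose old strand is
   closed at the new vertex. *)
case/existsP: (tc) => u /andP[uc tu].
have -> : (z \in B) = (u \in B).
  exact: invariant_porbit (run_invariant Bs Bts') cp zc uc.
have [X XD /andP[sX /eqP eX]] := strand_of ok u.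
rewrite -(chiB X u) // ?eX ?porbit_id //=.
have tX : touched t X.2.
  by apply/existsP; exists u; rewrite eX porbit_id.
apply: cchi; rewrite ?advD //.
  rewrite /= mem_cat; apply/orP; right; apply/mapP; exists c => //.
  by rewrite mem_filter mem_enum tc.
apply: (adjacent_at vs); first by rewrite /incident /= eqxx.
by rewrite /adv (advance_strand _ sX tX) /incident /= eqxx orbT.
Qed.

Lemma connected_run sigma ts : size ts = s -> 0 < d ->
  all (@is_transposition d) ts ->
  connected s (graph (run s sigma ts)) <->
  forall B, invariant_set B sigma ->
    (forall t, t \in ts -> invariant_set B t) -> B = set0 \/ B = setT.
Proof.
move=> szt d0 trs; have ss : size ts <= s by rewrite szt.
have ok := run_ok sigma ss; have [_ wts stg unq] := ok.
split=> [cG B Bs Bts|HB].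
  have [->|[z0 z0B]] := set_0Vmem B; first by left.
  right; apply/setP => z; rewrite inE.
  (* Each cycle lies inside B or outside it, so B colours the edges. *)
  pose chi (x : cycle_edge d) := [exists u in x.2, u \in B].
  have chiE x u : x \in (run s sigma ts).2 -> u \in x.2 -> chi x = (u \in B).
    move=> xD ux; apply/existsP/idP => [[w /andP[wx wB]]|uB]; last first.
      by exists u; rewrite ux.
    by rewrite (run_entry_invariant Bs Bts xD ux wx).
  have [X XD /andP[_ /eqP eX]] := strand_of ok z.
  have [Y YD /andP[_ /eqP eY]] := strand_of ok z0.
  rewrite -(chiE X) // ?eX ?porbit_id // -z0B -(chiE Y) // ?eY ?porbit_id //.
  have /connected_colouring := cG.
  move/(_ [seq (x.1, chi x) | x <- (run s sigma ts).2]).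
  rewrite -map_comp => /(_ erefl).
  have mD x : x \in (run s sigma ts).2 ->
      (x.1, chi x) \in [seq (x.1, chi x) | x <- (run s sigma ts).2].
    by move=> xD; apply/mapP; exists x.
  move=> /(_ _ (X.1, chi X) (Y.1, chi Y) (mD _ XD) (mD _ YD)); apply.
  move=> _ _ /mapP[x xD ->] /mapP[y yD ->] /= /hasP[v].
  rewrite mem_iota add1n ltnS => vs /andP[vx vy].
  rewrite -szt in vs.
  have /existsP[a /andP[ax ta]] := incident_touched ss xD vs vx.
  have /existsP[b /andP[by_ tb]] := incident_touched ss yD vs vy.
  rewrite (chiE x a) // (chiE y b) //.
  have /andP[v0 vts] := vs.
  have tt : nth 1%g ts (size ts - v) \in ts.
    by apply: mem_nth; rewrite ltn_subrL v0 (leq_trans v0 vts).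
  (* Both cycles contain p or q, and these two points are together inside or outside B. *)
  have /existsP[p /existsP[q /andP[pq /eqP tE]]] := allP trs _ tt.
  have := Bts _ tt p; rewrite tE tpermL => Bpq.
  move: ta tb; rewrite tE.
  by case: tpermP => [->|->|]; rewrite ?eqxx //; case: tpermP => [->|->|];
    rewrite ?eqxx.
apply/connected_colouring => D DG cD.
(* The colour is looked up by position, which the distinct entries determine; the edge alone would
   confuse parallel edges. *)
pose chi (x : cycle_edge d) := (nth (x.1, false) D (index x (run s sigma ts).2)).2.
have szD : size D = size (run s sigma ts).2.
  by rewrite -(size_map fst D) DG size_map.
have nthD x : x \in (run s sigma ts).2 ->
    nth (x.1, false) D (index x (run s sigma ts).2) = (x.1, chi x).
  move=> xD; rewrite [LHS]surjective_pairing; congr (_, _).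
  rewrite -(nth_map (x.1, false) x.1 fst) ?szD ?index_mem // DG.
  by rewrite (nth_map x) ?index_mem // nth_index.
have memD x : x \in (run s sigma ts).2 -> (x.1, chi x) \in D.
  by move=> xD; rewrite -nthD // mem_nth // szD index_mem.
have cchi : compatible_entries chi (run s sigma ts).2.
  move=> x y xD yD xy.
  exact: (cD (x.1, chi x) (y.1, chi y) (memD _ xD) (memD _ yD)).
have [B [Bs Bts chiB]] := colouring_invariant ss cchi.
have chiD p : p \in D -> exists2 x, x \in (run s sigma ts).2 & p.2 = chi x.
  move=> /(nthP p)[i iD <-]; rewrite szD in iD.
  have x0 : cycle_edge d by exact: (p.1, set0).
  exists (nth x0 (run s sigma ts).2 i); first exact: mem_nth.
  by rewrite /chi index_uniq // (set_nth_default p) ?szD.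
have chi_cst b : (forall z, (z \in B) = b) -> forall p, p \in D -> p.2 = b.
  move=> Bb p /chiD[x xD ->]; have /card_gt0P[z zx] : 0 < #|x.2|.
    have /eqP <- := allP wts x xD.
    by have /and4P[] := staged_mem stg xD.
  by rewrite (chiB x z).
move=> p q pD qD.
have [B0|BT] := HB B Bs Bts.
  by rewrite !(chi_cst false) // => z; rewrite B0 inE.
by rewrite !(chi_cst true) // => z; rewrite BT inE.
Qed.

End RunConnected.

(** * Balanced forks and wieners *)

Section DoubleEdges.

Variable s : nat.
Implicit Types (G H : mgraph) (e f : edge) (v i : nat).

Definition trivalent v G :=
  [&& size (closing v G) + size (opening v G) == 3, 0 < size (closing v G),
      0 < size (opening v G)
    & sumn [seq x.2 | x <- closing v G] == sumn (opening v G)].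

Lemma perm_trivalent v G H : perm_eq (closing v G) (closing v H) ->
  perm_eq (opening v G) (opening v H) -> trivalent v G = trivalent v H.
Proof.
move=> Ec Eo; rewrite /trivalent (perm_size Ec) (perm_size Eo).
by rewrite (perm_sumn Eo) (perm_sumn (perm_map snd Ec)).
Qed.

Lemma trivalent_moves i G H v : i < s -> staged s i G -> H \in moves s i.+1 G ->
  0 < v <= i.+1 -> (v <= i -> trivalent v G) -> trivalent v H.
Proof.
move=> si stG HG; have frG := staged_fresh si stG.
move=> /andP[v0]; rewrite leq_eqVlt ltnS => /orP[/eqP ->|vi] HT.
  case/join_or_cut: HG=> [[e [f [R [GE te tf _ ->]]]]|[e [a [R [GE te ae ->]]]]].
    move: frG; rewrite /fresh (perm_all _ GE) /= => /and3P[/andP[he _] /andP[hf _] HR].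
    rewrite /trivalent closing_join // !opening_cons /= (negbTE he) (negbTE hf).
    by rewrite eqxx opening_fresh //= !addn0.
  move: frG; rewrite /fresh (perm_all _ GE) /= => /andP[/andP[he _] HR].
  rewrite /trivalent closing_cut // opening_cut //= !addn0 subnKC //.
  by case/andP: ae => _ /ltnW.
rewrite -(perm_trivalent (G := G)) ?HT //.
  have lt1 : (i.+1 == v) = false by lia.
  have lt2 : (s.+1 == v) = false by lia.
  case/join_or_cut: HG=> [[e [f [R [GE te tf _ ->]]]]|[e [a [R [GE te ae ->]]]]];
    rewrite (permPl (perm_closing v GE)) !closing_cons /= te ?tf lt1 lt2;
    exact: perm_refl.
have lt1 : (i.+1 == v) = false by lia.
case/join_or_cut: HG=> [[e [f [R [GE te tf _ ->]]]]|[e [a [R [GE te ae ->]]]]];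
  rewrite (permPl (perm_opening v GE)) !opening_cons /= lt1; exact: perm_refl.
Qed.

Lemma trivalent_partial d eta i G v : is_partition d eta -> i <= s ->
  G \in partial_graphs s eta i -> 0 < v <= i -> trivalent v G.
Proof.
move=> heta; elim: i G => [|i IH] G si; first by case: v.
case/partial_graphsS=> G' HG' HM vi.
apply: (trivalent_moves si (staged_partial heta (ltnW si) HG') HM vi).
by move=> v_i; apply: IH => //; [exact: ltnW | case/andP: vi => ->].
Qed.

Section Trivalent.

Variable G : mgraph.
Hypotheses (stG : staged s s G) (triG : forall v, 0 < v <= s -> trivalent v G).

Lemma staged_edge e : e \in G ->
  [&& 0 < wt e, src e < tgt e, src e <= s & tgt e <= s.+1].
Proof. by move/(allP stG) => /and4P[-> -> ->] /=; lia. Qed.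

Lemma perm_tripod v : perm_eq (tripod v G)
  ([seq e <- G | tgt e == v] ++ [seq e <- G | src e == v]).
Proof.
have : all (fun e => src e != tgt e) G.
  by apply/allP => e /staged_edge; lia.
rewrite /tripod /incident; elim: (G) => //= e R IH /andP[he /IH {}IH].
have [sv|sv] := eqVneq (src e) v; have [tv|tv] := eqVneq (tgt e) v => //=.
- by rewrite sv tv eqxx in he.
- by rewrite perm_sym (perm_catCA _ [:: e]) /= perm_cons perm_sym.
- by rewrite perm_cons.
Qed.

Let double (A : mgraph) e : 1 < count_mem e A -> size A <= 2 -> perm_eq A [:: e; e].
Proof.
move=> h sA; rewrite -[A in perm_eq A](all_filterP (_ : all (pred1 e) A)).
  have cA : count_mem e A = 2.
    by apply/eqP; rewrite eqn_leq h (leq_trans (count_size _ _)).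
  have -> : [seq x <- A | pred1 e x] = nseq 2 e; last exact: perm_refl.
  rewrite -cA; elim: (A) => //= x B IH; case: eqP => [->|_] /=; by rewrite IH.
by rewrite all_count eqn_leq count_size (leq_trans sA).
Qed.

(** Equal edges lie on the same side of v. As v has three edges and none of its sides is empty, the
    third one is alone on the other side, and conservation of weight doubles its weight. *)
Lemma double_tripod v e : 0 < v <= s -> incident v e -> 1 < count_mem e G ->
  exists f, [/\ perm_eq (tripod v G) [:: e; e; f], wt f = 2 * wt e
              & src e = v -> tgt f = v].
Proof.
move=> vs ve e2; have eG : e \in G by rewrite -has_pred1 has_count ltnW.
have /and4P[e0 st _ _] := staged_edge eG.
have /and4P[/eqP sz c0 o0 /eqP sm] := triG vs.
rewrite /closing /opening !size_map in sz c0 o0.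
rewrite /closing -map_comp /= /opening in sm.
set A := [seq e <- G | tgt e == v] in sz c0 sm.
set B := [seq e <- G | src e == v] in sz o0 sm.
have tE : perm_eq (tripod v G) (A ++ B) := perm_tripod v.
case/orP: ve => /eqP ve.
  have eB : 1 < count_mem e B.
    rewrite count_filter (eq_count (a2 := pred1 e)) // => x /=.
    by case: eqP => // ->; rewrite ve eqxx.
  have szB := leq_trans eB (count_size _ _).
  have BE : perm_eq B [:: e; e].
    by apply: double => //; move: (size A) (size B) sz c0 => a b; lia.
  have sA : size A = 1 by move: (size A) (size B) sz c0 szB => a b; lia.
  case AE: A sA => [|f [|? ?]] // _; exists f; split.
  - by rewrite (permPl tE) AE perm_catC /= (perm_cat BE) // perm_refl.
  - by move: sm; rewrite (perm_sumn (perm_map _ BE)) AE /=; lia.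
  - have : f \in A by rewrite AE inE.
    by rewrite mem_filter => /andP[/eqP].
have eA : 1 < count_mem e A.
  rewrite count_filter (eq_count (a2 := pred1 e)) // => x /=.
  by case: eqP => // ->; rewrite ve eqxx.
have szA := leq_trans eA (count_size _ _).
have AE : perm_eq A [:: e; e].
  by apply: double => //; move: (size A) (size B) sz o0 => a b; lia.
have sB : size B = 1 by move: (size A) (size B) sz o0 szA => a b; lia.
case BE: B sB => [|f [|? ?]] // _; exists f; split.
- by rewrite (permPl tE) BE (perm_cat AE) // perm_refl.
- by move: sm; rewrite (perm_sumn (perm_map _ AE)) BE /=; lia.
- by move=> sv; rewrite ve sv ltnn in st.
Qed.

Lemma count_tripod v e : incident v e -> count_mem e (tripod v G) = count_mem e G.
Proof.
move=> ve; rewrite count_filter; apply: eq_count => x /=.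
by case: eqP => // ->.
Qed.

(** Weights are positive, so the edge of double weight differs from the other two; hence e is the
    entry that occurs twice. *)
Lemma balanced_uniq v e f e' f' : e \in G -> e' \in G ->
  perm_eq (tripod v G) [:: e; e; f] -> wt f = 2 * wt e ->
  balanced_at v G e' f' -> e' = e /\ f' = f.
Proof.
move=> /staged_edge/andP[e0 _] /staged_edge/andP[e'0 _] E wf.
case/andP=> E' /eqP wf'; rewrite (permPl E) in E'.
have ee : e' = e.
  have := seq.permP E' (pred1 e'); rewrite /= eqxx /=.
  have -> : (f' == e') = false by apply/eqP => ff; rewrite ff in wf'; lia.
  by case: (e =P e') => // _; case: (f == e').
split=> //; move: E'; rewrite ee !perm_cons => /perm_mem/(_ f).
by rewrite !inE eqxx => /esym/eqP.
Qed.

Lemma balanced_count v e f : e \in G -> balanced_at v G e f ->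
  incident v e /\ count_mem e G = 2.
Proof.
move=> eG /andP[E /eqP wf].
have /andP[e0 _] := staged_edge eG.
have : e \in tripod v G by rewrite (perm_mem E) inE eqxx.
rewrite mem_filter => /andP[ve _]; split=> //.
rewrite -(count_tripod ve) (seq.permP E) /= eqxx.
by have -> : (f == e) = false by apply/eqP => ff; rewrite ff in wf; lia.
Qed.

(* The vertex at which a balanced fork or a wiener with parallel edges [e] is
   recorded. *)
Definition record_vertex e := if src e == 0 then tgt e else src e.

(** A double edge recorded at v is part of a fork if it has an end over 0 or s+1, and of a wiener
    otherwise. By [balanced_uniq] no other double edge is recorded at v, so both sides are at most
    1. *)
Lemma recorded v : 0 < v <= s ->
  balanced_fork s G v + wiener s G v
  = count (fun e => (count_mem e G == 2) && (record_vertex e == v)) (undup G).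
Proof.
move=> vs; have /andP[v0 v_s] := vs.
have [/hasP[e eG /andP[/eqP e2 /eqP re]]|none] :=
    boolP (has (fun e => (count_mem e G == 2) && (record_vertex e == v)) (undup G)).
  rewrite mem_undup in eG.
  have ve : incident v e.
    by move: re; rewrite /record_vertex /incident; case: ifP => _ ->; rewrite eqxx ?orbT.
  have e1 : 1 < count_mem e G by rewrite e2.
  have [f [E wf tf]] := double_tripod vs ve e1.
  have fG : f \in G.
    have : f \in tripod v G by rewrite (perm_mem E) !inE eqxx !orbT.
    by rewrite mem_filter => /andP[].
  have bal : balanced_at v G e f by rewrite /balanced_at E wf eqxx.
  have forkE : balanced_fork s G v = (src e == 0) || (tgt e == s.+1).
    apply/hasP/idP => [[e' e'G /hasP[f' _ /andP[b]]]|h].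
      by have [-> _] := balanced_uniq eG e'G E wf b.
    by exists e => //; apply/hasP; exists f; rewrite ?bal.
  have wienerE : wiener s G v = [&& tgt f == v, src e == v & tgt e <= s].
    apply/hasP/idP => [[e' e'G /hasP[f' _ /andP[b]]]|h].
      by have [-> ->] := balanced_uniq eG e'G E wf b.
    by exists e => //; apply/hasP; exists f; rewrite ?bal.
  transitivity 1.
    have /and4P[_ st _ ts] := staged_edge eG.
    rewrite forkE wienerE; move: re tf; rewrite /record_vertex.
    have [-> _ _|s0 sv tf] := eqVneq (src e) 0.
      by rewrite (ltn_eqF v0) /= andbF.
    rewrite (tf sv) sv !eqxx /=.
    by have [->|te] := eqVneq (tgt e) s.+1; rewrite ?ltnn //=; lia.
  rewrite (eq_in_count (a2 := pred1 e)); last first.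
    move=> e' /=; rewrite mem_undup => e'G; apply/andP/eqP => [[/eqP e'2 /eqP re']|->].
      have ve' : incident v e'.
        by move: re'; rewrite /record_vertex /incident; case: ifP => _ ->;
          rewrite eqxx ?orbT.
      have e'1 : 1 < count_mem e' G by rewrite e'2.
      have [f' [E' wf' _]] := double_tripod vs ve' e'1.
      have b : balanced_at v G e' f' by rewrite /balanced_at E' wf' eqxx.
      by have [] := balanced_uniq eG e'G E wf b.
    by rewrite e2 re !eqxx.
  by rewrite count_uniq_mem ?undup_uniq // mem_undup eG.
have no e f : e \in G -> balanced_at v G e f -> record_vertex e != v.
  move=> eG /(balanced_count eG)[_ e2]; apply: contra none => re.
  by apply/hasP; exists e; rewrite ?mem_undup // e2 eqxx.
transitivity 0; last by apply/esym/eqP; rewrite -leqn0 leqNgt -has_count.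
have -> : wiener s G v = false.
  apply/negP => /hasP[e eG /hasP[f _ /andP[b /and3P[_ /eqP sv _]]]].
  move: (no e f eG b); rewrite /record_vertex sv.
  by rewrite (gtn_eqF v0) eqxx.
suff -> : balanced_fork s G v = false by [].
apply/negP => /hasP[e eG /hasP[f _ /andP[b h]]].
have [ve _] := balanced_count eG b.
move: (no e f eG b); rewrite /record_vertex; move: ve h; rewrite /incident.
have [->|s0] := eqVneq (src e) 0; first by rewrite (ltn_eqF v0) /= => ->.
case/orP=> [->//|/eqP ->] /= /eqP vz; move: v_s; by rewrite vz ltnn.
Qed.

(** The recorded vertex could fail to be inner only for an edge from 0 to s+1. Such an edge meets no
    vertex, so giving it a colour of its own is compatible, although another edge exists at vertex
    1. *)
Lemma connected_inner e : 0 < s -> connected s G -> e \in G ->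
  0 < record_vertex e <= s.
Proof.
move=> s0 /connected_colouring cG eG.
have /and4P[_ st ss ts] := staged_edge eG.
rewrite /record_vertex; have [se|se] := eqVneq (src e) 0; last first.
  by rewrite lt0n se.
rewrite (leq_ltn_trans _ st) //= -ltnS ltn_neqAle ts andbT; apply/eqP => te.
have non v : 0 < v <= s -> ~~ incident v e by rewrite /incident se te; lia.
have /and4P[_ c0 _ _] : trivalent 1 G by apply: triG.
have [f fG tf] : exists2 f, f \in G & tgt f = 1.
  rewrite /closing size_map -has_predT in c0; case/hasP: c0 => f.
  by rewrite mem_filter => /andP[/eqP tf fG] _; exists f.
have fe : f != e by apply: contraTneq (non 1 s0) => <-; rewrite /incident tf eqxx orbT.
have := cG [seq (h, h == e) | h <- G]; rewrite -map_comp map_id => /(_ erefl).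
move=> cD; suff /cD : compatible s [seq (h, h == e) | h <- G].
  have mD h : h \in G -> (h, h == e) \in [seq (h, h == e) | h <- G].
    by move=> hG; apply/mapP; exists h.
  by move=> /(_ _ _ (mD e eG) (mD f fG)); rewrite /= eqxx (negbTE fe).
move=> _ _ /mapP[x _ ->] /mapP[y _ ->] /= /hasP[v].
rewrite mem_iota add1n ltnS => /non ve /andP[vx vy].
have [xe|_] := eqVneq x e; first by rewrite xe (negbTE ve) in vx.
by have [ye|//] := eqVneq y e; rewrite ye (negbTE ve) in vy.
Qed.

(** All multiplicities are 1 or 2, so the product of their factorials is 2 to the number of double
    edges. Each double edge is recorded at exactly one inner vertex, and [recorded] is summed over
    these. *)
Lemma nb_sym_trivalent : 0 < s -> connected s G ->
  nb_sym G = 2 ^ (nb_balanced_forks s G + nb_wieners s G).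
Proof.
move=> s0 cG; rewrite nb_sym_fact.
have inner e : e \in G -> 0 < record_vertex e <= s by apply: connected_inner.
have -> : nb_balanced_forks s G + nb_wieners s G
    = count (fun e => count_mem e G == 2) (undup G).
  transitivity (\sum_(v <- iota 1 s) (balanced_fork s G v + wiener s G v)).
    rewrite /nb_balanced_forks /nb_wieners.
    elim: (iota 1 s) => [|v l IH]; first by rewrite big_nil.
    by rewrite big_cons -IH /= addnACA.
  transitivity (\sum_(v <- iota 1 s)
     count (fun e => (count_mem e G == 2) && (record_vertex e == v)) (undup G)).
    rewrite big_seq [RHS]big_seq; apply: eq_bigr => v.
    by rewrite mem_iota add1n ltnS => /recorded.
  under eq_bigr => v _ do rewrite -sum1_count big_mkcond.
  rewrite exchange_big /= -[RHS]sum1_count [RHS]big_mkcond /=.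
  rewrite big_seq [RHS]big_seq.
  apply: eq_bigr => e; rewrite mem_undup => eG.
  rewrite -big_mkcond sum1_count; case: (_ == 2) => /=; last exact: count_pred0.
  rewrite (eq_count (a2 := pred1 (record_vertex e))) => [|v]; last by rewrite /= eq_sym.
  by rewrite count_uniq_mem ?iota_uniq // mem_iota add1n ltnS inner.
rewrite -sum1_count expn_sum [RHS]big_mkcond big_seq [RHS]big_seq.
apply: eq_bigr => e; rewrite mem_undup => eG.
have [e1|] := ltnP 1 (count_mem e G); last by case: (count_mem e G) => [|[]].
have ve : incident (record_vertex e) e.
  by rewrite /record_vertex /incident; case: ifP => _; rewrite eqxx ?orbT.
have [f [E wf _]] := double_tripod (inner e eG) ve e1.
have b : balanced_at (record_vertex e) G e f by rewrite /balanced_at E wf eqxx.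
by have [_ ->] := balanced_count eG b.
Qed.

End Trivalent.
End DoubleEdges.

(** * Hurwitz numbers *)

(** Without vertices no two edges are adjacent, so every colouring is compatible. This settles s =
    0, where there is no vertex at which to record a double edge. *)
Lemma connected_no_vertex (G : mgraph) : connected 0 G -> size G <= 1.
Proof.
case: G => [|e [|f R]] // /connected_colouring cG.
have := cG ((e, true) :: [seq (g, false) | g <- f :: R]).
rewrite /= -map_comp map_id => /(_ erefl) cD.
suff /cD : compatible 0 [:: (e, true), (f, false) & [seq (g, false) | g <- R]].
  by move=> /(_ (e, true) (f, false)); rewrite !inE !eqxx orbT => /(_ isT isT).
by [].
Qed.

Lemma nb_sym_connected s d eta (G : mgraph) : is_partition d eta ->
  G \in partial_graphs s eta s -> connected s G ->
  nb_sym G = 2 ^ (nb_balanced_forks s G + nb_wieners s G).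
Proof.
move=> heta GP cG; have [s0|s0] := posnP s.
  move: cG; rewrite s0 => /connected_no_vertex.
  by rewrite /nb_balanced_forks /nb_wieners /=; case: (G) => [|e [|]].
apply: nb_sym_trivalent => //; first exact: (staged_partial heta (leqnn s) GP).
by move=> v vs; exact: (trivalent_partial heta (leqnn s) GP vs).
Qed.

Section HurwitzTuples.

Variables (s d : nat) (eta nu : seq nat).
Hypothesis d_gt0 : 0 < d.

(** Runs list the last transposition first, whence [rev_ord]. The last permutation is forced by the
    product being 1. *)
Definition tuple_of_run (r : 'S_d * s.-tuple 'S_d) :
    'S_d * {ffun 'I_s -> 'S_d} * 'S_d :=
  (r.1, [ffun i => tnth r.2 (rev_ord i)], ((tuple_run s r).1^-1)%g).

Lemma tuple_of_run_inj : injective tuple_of_run.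
Proof.
move=> [a u] [b w] [-> uw _]; congr (_, _); apply: eq_from_tnth => i.
by have /ffunP/(_ (rev_ord i)) := uw; rewrite !ffunE rev_ordK.
Qed.

Lemma tuple_run_prod (r : 'S_d * s.-tuple 'S_d) :
  (tuple_run s r).1 = (r.1 * \prod_(i < s) tnth r.2 (rev_ord i))%g.
Proof.
rewrite /tuple_run run_fst (big_nth 1%g) big_mkord size_rev size_tuple.
congr (_ * _)%g; apply: eq_bigr => i _.
by rewrite nth_rev ?size_tuple // (tnth_nth 1%g).
Qed.

Lemma final_weights_run (r : 'S_d * s.-tuple 'S_d) :
  perm_eq (final_weights s (graph (tuple_run s r))) nu
  = has_cycle_type (tuple_run s r).1 nu.
Proof.
have [cyc wts _ _] := tuple_run_ok (s := s) r (leqnn s).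
rewrite /has_cycle_type -(permPl (perm_map _ cyc)) -map_comp.
congr (perm_eq _ _); rewrite /final_weights /strands /graph filter_map -map_comp.
apply/eq_in_map => x; rewrite mem_filter => /andP[_ xD] /=.
exact/eqP/(allP wts).
Qed.

Lemma hurwitz_tuple_of_run (r : 'S_d * s.-tuple 'S_d) :
  is_hurwitz_tuple eta nu (tuple_of_run r)
  = valid_run eta r && (connected s (graph (tuple_run s r))
      && perm_eq (final_weights s (graph (tuple_run s r))) nu).
Proof.
rewrite final_weights_run /is_hurwitz_tuple /tuple_of_run /valid_run.
case: (has_cycle_type r.1 eta) => //=.
have -> : has_cycle_type (tuple_run s r).1^-1 nu
    = has_cycle_type (tuple_run s r).1 nu by rewrite /has_cycle_type porbitsV.
case: (has_cycle_type (tuple_run s r).1 nu); rewrite ?andbF //= andbT.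
have -> : [forall i, is_transposition ([ffun i => tnth r.2 (rev_ord i)] i)]
    = all (@is_transposition d) r.2.
  apply/forallP/all_tnthP => trs i.
    by have := trs (rev_ord i); rewrite ffunE rev_ordK.
  by rewrite ffunE.
case: (boolP (all _ _)) => //= trs.
under eq_bigr => i _ do rewrite ffunE.
rewrite -tuple_run_prod mulgV eqxx /=.
have bool_iff (b c : bool) : (b <-> c) -> b = c.
  by case: b c => [] [] // [h1 h2]; [have := h1 isT | have := h2 isT].
apply: bool_iff.
have C := connected_run r.1 (size_tuple r.2) d_gt0 trs.
rewrite -/(tuple_run s r) in C.
apply: (iff_trans (transitive_invariant _ d_gt0)).
apply: (iff_trans _ (iff_sym C)); split=> HB B.
  (* The last permutation is the inverse of the product of the others, so it preserves every set
     that they preserve. *)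
  move=> Bs Bts; apply: HB => p; rewrite !inE -orbA => /or3P[/eqP ->|/eqP ->|] //.
    by apply: invariant_setV; apply: run_invariant.
  by case/imsetP=> i _ ->; rewrite ffunE; apply: Bts; apply: mem_tnth.
move=> HA; apply: HB => [|t]; first by apply: HA; rewrite !inE eqxx.
case/tnthP=> i ->; apply: HA; rewrite inE; apply/orP; right.
by apply/imsetP; exists (rev_ord i); rewrite ?ffunE ?rev_ordK.
Qed.

Lemma card_hurwitz_tuples :
  #|[set x | @is_hurwitz_tuple d s eta nu x]|
  = #|[set r : 'S_d * s.-tuple 'S_d | valid_run eta r
        && (connected s (graph (tuple_run s r))
            && perm_eq (final_weights s (graph (tuple_run s r))) nu)]|.
Proof.
rewrite -[RHS](card_imset _ tuple_of_run_inj); congr #|pred_of_set _|.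
apply/setP => x; rewrite inE; apply/idP/imsetP => [hx|[r]]; last first.
  by rewrite inE -hurwitz_tuple_of_run => hr ->.
case: x hx => [[a tau] b] hx.
pose r : 'S_d * s.-tuple 'S_d := (a, [tuple tau (rev_ord i) | i < s]).
have tauE : [ffun i => tnth r.2 (rev_ord i)] = tau.
  by apply/ffunP => i; rewrite ffunE tnth_mktuple rev_ordK.
have xE : (a, tau, b) = tuple_of_run r.
  rewrite /tuple_of_run tauE; congr (_, _).
  have /and5P[_ _ _ /eqP + _] := hx; rewrite tuple_run_prod /= => ab1.
  under eq_bigr => i _ do rewrite tnth_mktuple rev_ordK.
  by apply/eqP; rewrite -(inj_eq (mulgI (a * \prod_(i < s) tau i)%g)) ab1 mulgV.
by exists r => //; rewrite inE -hurwitz_tuple_of_run -xE.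
Qed.

End HurwitzTuples.

Import GRing.Theory.
Local Open Scope ring_scope.

Theorem lemma4p2 (g d : nat) (eta nu : seq nat)
    (hd : (1 <= d)%N)
    (heta : is_partition d eta) (hnu : is_partition d nu)
    (hs : (2 <= 2 * g + size eta + size nu)%N) :
  let s := nb_branch g eta nu in
  hurwitz g d eta nu =
    \sum_(G <- monodromy_graphs g eta nu)
       (epsilon d eta)%:R
       * (aut_size eta)%:R
       * (\prod_(1 <= v < s.+1) (vertex_weight G v)%:R)
       * (1 / 2%:R) ^+ (nb_balanced_forks s G + nb_wieners s G)
       * (1 / (d`!)%:R).
Proof.
move=> s; rewrite /hurwitz -/s card_hurwitz_tuples //.
pose C G := connected s G && perm_eq (final_weights s G) nu.
rewrite (@card_runs s d eta C s) //; last first.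
  move=> G H GH; rewrite /C (connected_iso s GH); congr (_ && _).
  by rewrite (permPl (perm_map wt (perm_filter (fun e => tgt e == s.+1) GH))).
rewrite /monodromy_graphs -/s big_filter natr_sum mulr_suml.
rewrite big_seq_cond [RHS]big_seq_cond; apply: eq_bigr => G /andP[GP /andP[cG _]].
rewrite !mul1r; congr (_ / _).
have := nb_runsE heta (leqnn s) GP; rewrite (nb_sym_connected heta GP cG).
move/(congr1 (fun n => n%:R : rat)); rewrite !natrM natrX natr_prod => <-.
by rewrite exprVn mulfK // expf_neq0.
Qed.
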